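(* Let $(X,d)$ be a closed Alexandrov space of curvature bounded from above by $K$. Suppose that the $k_0$-th homology group $H_{k_0}(X)$ is nonzero for some $k_0\ge 1$. Then $(X,d)$ admits at least one non-trivial closed geodesic.
   Context: A shortest arc joining $A,B$ in a metric space is a curve joining them with length $d(A,B)$; a metric space is geodesically connected if any two points are joined by a shortest arc. The $K$-plane is the $2$-dimensional model space of constant curvature $K$: $\mathbf{R}^2$ if $K=0$, the standard Euclidean $2$-hemisphere of radius $1/\sqrt K$ if $K>0$, the hyperbolic plane of curvature $K$ if $K<0$. An $\mathfrak{R}_K$ domain (a $CAT(K)$ space) is a metric space such that: (i) it is geodesically connected; (ii) if $K>0$, the perimeter of each triangle is less than $2\pi/\sqrt K$; (iii) for each triangle $\triangle ABC$ and its comparison triangle $\triangle\overline A\,\overline B\,\overline C$ in the $K$-plane (same corresponding side lengths), if $D$ is on the side $AC$ and $\overline D$ is the point on $\overline A\,\overline C$ with $d(A,D)=d_{K\text{-plane}}(\overline A,\overline D)$, then $d(B,D)\le d_{K\text{-plane}}(\overline B,\overline D)$. A metric space $(X,d)$ is an Alexandrov space of curvature bounded from above by $K$ if each point of $X$ is contained in some neighborhood that is an $\mathfrak{R}_K$ domain. ''Closed'' means compact and without boundary. A closed geodesic (possibly self-intersecting) is a constant speed closed curve $\mathbf{S}^1\to X$ that is locally length minimizing; it is non-trivial if it is not a constant map. *)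

(* Defs.v *)
From HB Require Import structures.
From mathcomp Require Import all_boot all_order all_algebra.
From mathcomp Require Import all_classical all_reals all_analysis.
From mathcomp Require Import freeg.

Set Implicit Arguments.
Unset Strict Implicit.
Unset Printing Implicit Defensive.

Import Order.TTheory GRing.Theory Num.Theory.
Import numFieldNormedType.Exports.

Local Open Scope classical_set_scope.
Local Open Scope ring_scope.

(* Curves are studied for a bare distance function d on a type T: this covers
   at once a metric space, a subset of it with the induced distance, and the
   K-plane. *)
Section curves.
Context {R : realType} {T : Type} (d : T -> T -> R).
Implicit Types (f : R -> T) (A B : T) (a b : R).

Definition curve_on a b f : Prop :=
  a <= b /\
  {in `[a, b], forall t, d (f s) (f t) @[s --> within `[a, b] (nbhs t)] --> 0}.

Definition polygon_length a b f (s : seq R) : R :=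
  let F := f \o nth b (a :: s) in
  \sum_(0 <= n < size s) d (F n) (F n.+1).

Definition curve_length a b f : \bar R :=
  ereal_sup [set (polygon_length a b f s)%:E | s in itv_partition a b].

Definition shortest_arc A B a b f : Prop :=
  [/\ curve_on a b f, f a = A, f b = B & curve_length a b f = (d A B)%:E].

Definition on_arc a b f (D : T) : Prop := exists2 t, t \in `[a, b] & D = f t.

Definition geodesically_connected : Prop :=
  forall A B, exists a b f, shortest_arc A B a b f.

End curves.

Section model_plane.
Context {R : realType}.
Implicit Types (K x : R) (p q : R * R * R).

Definition arcosh x : R := ln (x + Num.sqrt (x ^+ 2 - 1)).

Definition dot3 p q : R := p.1.1 * q.1.1 + p.1.2 * q.1.2 + p.2 * q.2.

Definition minkowski3 p q : R := p.2 * q.2 - p.1.1 * q.1.1 - p.1.2 * q.1.2.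

(* Subsets of R^3.  K > 0: hemisphere of radius 1 / sqrt K, with its angular distance;
   K = 0: the plane R^2 x {0};
   K < 0: upper sheet of the hyperboloid z^2 - x^2 - y^2 = 1 / - K. *)
Definition kplane_carrier K : set (R * R * R) :=
  [set p | if 0 < K then dot3 p p = K^-1 /\ 0 <= p.2
           else if K < 0 then minkowski3 p p = (- K)^-1 /\ 0 < p.2
           else p.2 = 0].

Definition kplane K : Type := set_type (kplane_carrier K).

Definition kplane_dist K (P Q : kplane K) : R :=
  let p := \val P in let q := \val Q in
  if 0 < K then acos (K * dot3 p q) / Num.sqrt K
  else if K < 0 then arcosh (- K * minkowski3 p q) / Num.sqrt (- K)
  else Num.sqrt (dot3 (p - q) (p - q)).

End model_plane.

Section curvature.
Context {R : realType}.

Section RK_domain.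
Context {T : Type} (d : T -> T -> R) (K : R).

Definition comparison_triangle (A B C : T) (A' B' C' : kplane K) : Prop :=
  [/\ kplane_dist A' B' = d A B, kplane_dist B' C' = d B C
    & kplane_dist A' C' = d A C].

Definition RK_domain : Prop :=
  [/\ geodesically_connected d,
      0 < K -> forall A B C : T, d A B + d B C + d A C < 2 * pi / Num.sqrt K
    & forall (A B C D : T) (a b : R) (f : R -> T)
             (A' B' C' D' : kplane K) (a' b' : R) (f' : R -> kplane K),
        comparison_triangle A B C A' B' C' ->
        shortest_arc d A C a b f -> on_arc a b f D ->
        shortest_arc (@kplane_dist R K) A' C' a' b' f' -> on_arc a' b' f' D' ->
        d A D = kplane_dist A' D' -> d B D <= kplane_dist B' D'].

End RK_domain.

Definition induced_dist (X : metricType R) (U : set X) (x y : U) : R :=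
  mdist (\val x) (\val y).

Definition curvature_bounded_above (X : metricType R) (K : R) : Prop :=
  forall x : X, exists2 U : set X, nbhs x U & RK_domain (@induced_dist X U) K.

End curvature.

Section without_boundary.
Context (R : realType).

Definition half_space n : set 'rV[R]_n.+1 := [set v | 0 <= v ord0 ord0].

(* Boundary in the topological sense used for manifolds with boundary:
   x has an open neighbourhood U and a homeomorphism f from U onto a relatively
   open subset of a closed half-space, sending x to the bounding hyperplane. *)
Definition boundary_point (X : topologicalType) (x : X) : Prop :=
  exists (n : nat) (U : set X) (V : set 'rV[R]_n.+1)
         (f : X -> 'rV[R]_n.+1) (g : 'rV[R]_n.+1 -> X),
    [/\ open U, U x, open V & f x ord0 ord0 = 0] /\
    [/\ {within U, continuous f},
        {within V `&` @half_space n, continuous g},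
        f @` U = V `&` @half_space n
      & forall y, U y -> g (f y) = y].

Definition without_boundary (X : topologicalType) : Prop :=
  forall x : X, ~ boundary_point x.

Definition closed_space (X : topologicalType) : Prop :=
  compact [set: X] /\ without_boundary X.

End without_boundary.

Section closed_geodesics.
Context {R : realType} {X : metricType R}.
Implicit Type g : R -> X.

(* Maps from the circle R / 2 pi Z are represented by 2 pi-periodic maps. *)
Definition closed_curve g : Prop :=
  continuous g /\ forall t, g (t + 2 * pi) = g t.

Definition constant_speed g : Prop :=
  exists v : R, forall a b, a <= b ->
    curve_length (@mdist R X) a b g = (v * (b - a))%:E.

Definition locally_minimizing g : Prop :=
  forall t, exists2 e : R, 0 < e &
    shortest_arc (@mdist R X) (g (t - e)) (g (t + e)) (t - e) (t + e) g.

Definition closed_geodesic g : Prop :=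
  [/\ closed_curve g, constant_speed g & locally_minimizing g].

Definition constant_curve g : Prop := exists x, forall t, g t = x.

End closed_geodesics.

(* Singular homology with integer coefficients. *)
Section homology.
Context (R : realType).

Definition std_simplex k : set 'rV[R]_k.+1 :=
  [set t | (forall j, 0 <= t ord0 j) /\ \sum_j t ord0 j = 1].

Definition simplex k : topologicalType := set_type (@std_simplex k).

Definition face_row k (i : 'I_k.+2) (t : 'rV[R]_k.+1) : 'rV[R]_k.+2 :=
  \row_j oapp (t ord0) 0 (unlift i j).

Lemma face_row_simplex k i (t : simplex k) :
  @std_simplex k.+1 (face_row i (\val t)).
Proof.
have [t0 t1] := set_valP t; split.
  by move=> j; rewrite mxE; case: unliftP => [j' _|_] //=; exact: t0.
rewrite (bigD1_ord i) //= mxE unlift_none /= add0r -[RHS]t1.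
by apply: eq_bigr => j _; rewrite mxE liftK.
Qed.

Definition face_fun k (i : 'I_k.+2) (t : simplex k) : simplex k.+1 :=
  SigSub (mem_set (face_row_simplex i t)).

Lemma continuous_face k i : continuous (@face_fun k i).
Proof.
apply: continuous_comp_initial => t.
apply: (@continuous_comp _ _ _ set_val (face_row i)).
  exact: initial_continuous.
move=> A /nbhs_ballP[e e0 eA]; apply/nbhs_ballP; exists e => //= v [_ tv].
apply: eA; split=> // r j; rewrite !mxE !ord1.
by case: (unlift i j) => [j'|] /=; [exact: tv | exact: ballxx].
Qed.

Definition face k (i : 'I_k.+2) : continuousType (simplex k) (simplex k.+1) :=
  mkcts (@continuous_face k i).

Context (X : topologicalType).

Definition sing k : choiceType := continuousType (simplex k) X.

Definition chain k := {freeg (sing k) / int}.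

Definition boundary_sing k (s : sing k.+1) : chain k :=
  \sum_(i < k.+2) (-1) ^+ i *: << ((s \o face i : continuousType _ _) : sing k) >>.

Definition boundary k : chain k.+1 -> chain k := fglift (@boundary_sing k).

Lemma boundaryB k : {morph @boundary k : c c' / c - c'}.
Proof. exact: lift_is_additive. Qed.

Lemma boundary0 k : @boundary k 0 = 0.
Proof. by rewrite -(subrr 0) boundaryB subrr. Qed.

Definition cycle_pred k : {pred chain k} :=
  match k with
  | 0 => xpredT
  | k'.+1 => fun c => boundary c == 0
  end.

Lemma cycle_zmod_closed k : zmod_closed (@cycle_pred k).
Proof.
case: k => [|k]; first by [].
split=> [|c c']; rewrite !unfold_in /=; first by rewrite boundary0.
by rewrite boundaryB => /eqP -> /eqP ->; rewrite subrr.
Qed.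

HB.instance Definition _ k :=
  GRing.isZmodClosed.Build (chain k) (@cycle_pred k) (@cycle_zmod_closed k).

Record cycle k := Cycle { chain_of :> chain k; _ : chain_of \in @cycle_pred k }.

HB.instance Definition _ k := [isSub for @chain_of k].
HB.instance Definition _ k := [Choice of cycle k by <:].
HB.instance Definition _ k := [SubChoice_isSubZmodule of cycle k by <:].

Definition bounding k : {pred cycle k} :=
  fun z => `[< exists c : chain k.+1, boundary c = z >].

Lemma bounding_zmod_closed k : zmod_closed (@bounding k).
Proof.
split=> [|z z']; rewrite !unfold_in; first by apply/asboolP; exists 0; exact: boundary0.
move=> /asboolP[c cz] /asboolP[c' cz']; apply/asboolP; exists (c - c').
by rewrite boundaryB cz cz'.
Qed.

HB.instance Definition _ k :=
  GRing.isZmodClosed.Build (cycle k) (@bounding k) (@bounding_zmod_closed k).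

Definition homology k : zmodType := Quotient.quot (@bounding k : zmodClosed (cycle k)).

End homology.

(* Main.v *)
Require Import Defs.
From HB Require Import structures.
From mathcomp Require Import freeg.
From mathcomp Require Import all_boot all_order all_algebra.
From mathcomp Require Import all_classical all_reals all_analysis.
From mathcomp Require Import ring lra zify.

Set Implicit Arguments.
Unset Strict Implicit.
Unset Printing Implicit Defensive.

Import Order.TTheory GRing.Theory Num.Theory.
Import numFieldNormedType.Exports.

Local Open Scope classical_set_scope.
Local Open Scope ring_scope.

(* Comparison with degenerate triangles shows that points of X at distance less
   than some r > 0 are joined by a unique shortest arc; by compactness it depends
   continuously on its endpoints, and no other consequence of the curvature
   bound is needed.  Birkhoff's process replaces the vertices of a closed N-gon
   with short edges by the midpoints of its edges.  This decreases the energy, the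
   sum of the squares of the lengths of the edges, unless all edges have the
   same length and the polygon has no corners, i.e. unless it is a closed geodesic
   or a point.  Hence, if there are no closed geodesics, the N-gons are shortened
   uniformly by iteration.  A map from a sphere to X is a family of loops,
   parametrized by a ball and constant over its boundary: these loops are
   approximated by N-gons, which are shortened until they can be contracted
   along geodesics, so that the map extends to the ball.  In particular every
   map from the boundary of a simplex of dimension at least 2 extends to the
   simplex; coning off singular simplices one dimension at a time gives a
   contraction of the singular complex in positive degrees. *)

(** * Uniqueness of short geodesics *)

(** The argument is by contraposition, without minimax. The obstacle is that the shortening must act
    on a whole family of loops at once, continuously in the parameter, and that each step must be a
    homotopy. One constant r takes care of this: edges are at most r / 4, so that a polygon and its
    midpoint polygon, parametrized alike, stay at distance less than r, and the short geodesics
    between them provide the homotopy. The number N of vertices is the same for the whole family;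
    N-gons of energy bounded below form a compact set, hence one number of iterations serves every
    loop. Spheres of dimension m + 1 lie in R^m x R^2, the loops being circles of the second factor;
    for m = 0 the ball is a point and a single loop is treated in the same way. Extension is proved
    backwards: the last, short polygons extend over the ball, and extendability is carried back
    through each homotopy. Cones over singular simplices then take the place of a Hurewicz argument,
    with one base point in each path component since X may be disconnected. *)

Section curve_length.
Context {R : realType} {T : Type} (d : T -> T -> R).
Implicit Types (a b v h : R) (s : seq R) (f : R -> T).

Lemma itv_partition_step a b s n : itv_partition a b s -> (n < size s)%N ->
  [/\ a <= nth b (a :: s) n, nth b (a :: s) n < nth b (a :: s) n.+1
    & nth b (a :: s) n.+1 <= b].
Proof.
move=> abs ns; split.
- by apply: itv_partition_nth_ge abs; rewrite ltnS ltnW.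
- by have [/(pathP b) + _] := abs; exact.
- exact: itv_partition_nth_le abs.
Qed.

Lemma itv_partition_telescope a b s : itv_partition a b s ->
  \sum_(0 <= n < size s) (nth b (a :: s) n.+1 - nth b (a :: s) n) = b - a.
Proof.
move=> abs; rewrite (telescope_sumr (fun n => nth b (a :: s) n)) //.
by rewrite (itv_partition_nth_size _ abs).
Qed.

Lemma isometric_curve_length a b f v : a <= b ->
  (forall t u, a <= t -> t <= u -> u <= b -> d (f t) (f u) = v * (u - t)) ->
  curve_length d a b f = (v * (b - a))%:E.
Proof.
move=> ab fv; rewrite /curve_length.
have pl s : itv_partition a b s -> polygon_length d a b f s = v * (b - a).
  move=> abs; rewrite -(itv_partition_telescope abs) mulr_sumr.
  apply: eq_big_nat => n /andP[_ ns].
  by have [? /ltW ? ?] := itv_partition_step abs ns; rewrite /= fv.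
have [s abs] : exists s, itv_partition a b s.
  have [<-|/eqP anb] := eqVneq a b; first by exists [::]; split.
  by exists [:: b]; apply: itv_partition1; rewrite lt_neqAle ab andbT; apply/eqP.
apply/eqP; rewrite eq_le; apply/andP; split.
  by apply: ge_ereal_sup => _ [s' /pl + <-] => ->.
by apply: ereal_sup_ubound; exists s => //; rewrite pl.
Qed.

Lemma local_isometry_lipschitz f v h :
  (forall x y z, d x z <= d x y + d y z) -> (forall x, d x x = 0) -> 0 < h ->
  (forall t u, t <= u -> u - t <= h -> d (f t) (f u) = v * (u - t)) ->
  forall t u, t <= u -> d (f t) (f u) <= v * (u - t).
Proof.
move=> tri d0 h0 fv.
have step n t u : t <= u -> u - t <= h *+ n -> d (f t) (f u) <= v * (u - t).
  elim: n t u => [|n IH] t u tu.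
    by rewrite mulr0n => ut; (have -> : t = u by lra); rewrite d0 subrr mulr0.
  have [uth|hut] := leP (u - t) h; first by rewrite fv.
  rewrite mulrS => utn; apply: (le_trans (tri _ (f (t + h)) _)).
  have -> : v * (u - t) = v * (t + h - t) + v * (u - (t + h)) by ring.
  by apply: lerD; [rewrite fv|apply: IH]; lra.
move=> t u tu; apply: (step (Num.truncn ((u - t) / h)).+1) => //.
rewrite -mulr_natr mulrC -ler_pdivrMr//.
by apply: ltW; rewrite truncnS_gt.
Qed.

(** Only small scales are isometric: the distance between far parameters may fall below
    [v * (u - t)], as on a closed curve. The Lipschitz bound controls every polygon, and a partition
    of mesh at most [h] attains it. *)
Lemma local_isometry_curve_length f v h a b :
  (forall x y z, d x z <= d x y + d y z) -> (forall x, d x x = 0) -> 0 < h ->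
  (forall t u, t <= u -> u - t <= h -> d (f t) (f u) = v * (u - t)) ->
  a <= b -> curve_length d a b f = (v * (b - a))%:E.
Proof.
move=> tri d0 h0 fv ab; have fl := local_isometry_lipschitz tri d0 h0 fv.
have fine : exists2 s, itv_partition a b s & polygon_length d a b f s = v * (b - a).
  have [->|anb] := eqVneq a b.
    by exists [::]; [split|rewrite /polygon_length big_nil subrr mulr0].
  have {anb}ab' : a < b by rewrite lt_neqAle anb.
  pose n := (Num.truncn ((b - a) / h)).+1; pose e := (b - a) / n%:R.
  have n0 : n%:R != 0 :> R by rewrite pnatr_eq0.
  have e0 : 0 < e by rewrite divr_gt0 ?subr_gt0// ltr0n.
  have eh : e <= h.
    rewrite ler_pdivrMr ?ltr0n// mulrC -ler_pdivrMr//.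
    by apply: ltW; rewrite truncnS_gt.
  pose x i := a + e *+ i.
  have xn : x n = b by rewrite /x -mulr_natr divfK// addrC subrK.
  pose s := [seq x i | i <- iota 1 n].
  have nths i : (i <= n)%N -> nth b (a :: s) i = x i.
    case: i => [|i] i_n; first by rewrite /x mulr0n addr0.
    by rewrite /= (nth_map 0%N) ?size_iota// nth_iota// add1n.
  have szs : size s = n by rewrite size_map size_iota.
  have abs : itv_partition a b s.
    split; last by rewrite (last_nth b) szs nths ?xn.
    apply/(pathP b) => i; rewrite szs => i_n.
    have -> : nth b s i = x i.+1 by exact: nths i.+1 i_n.
    rewrite nths ?(ltnW i_n)// /x mulrS; lra.
  exists s => //; rewrite -(itv_partition_telescope abs) mulr_sumr /polygon_length.
  apply: eq_big_nat => i; rewrite szs => /andP[_ i_n].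
  rewrite /comp !nths ?(ltnW i_n)//; apply: fv; rewrite /x mulrS; lra.
have [s abs sl] := fine.
apply/eqP; rewrite eq_le; apply/andP; split; last first.
  by apply: ereal_sup_ubound; exists s => //; rewrite sl.
apply: ge_ereal_sup => _ [s' abs' <-].
rewrite lee_fin -(itv_partition_telescope abs') mulr_sumr.
apply: ler_sum_nat => n /andP[_ ns].
by have [_ /ltW ? _] := itv_partition_step abs' ns; exact: fl.
Qed.

(** The two-edge polygon through [f t] is one of those whose supremum is the length. At the ends of
    the interval [[:: t; b]] is not a partition, hence the separate cases. *)
Lemma shortest_arc_additive (A B : T) a b f t : (forall x, d x x = 0) ->
  shortest_arc d A B a b f -> t \in `[a, b] -> d A (f t) + d (f t) B <= d A B.
Proof.
move=> d0 [[ab fc] fa fb fl]; rewrite in_itv/= => /andP[at_ tb].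
have [at'|ta] := ltP a t; last first.
  by (have -> : t = a by lra); rewrite fa d0 add0r.
have [tb'|bt] := ltP t b; last first.
  by (have -> : t = b by lra); rewrite fb d0 addr0.
rewrite -lee_fin -fl; apply: ereal_sup_ubound; exists [:: t; b].
  by split => //=; rewrite at' tb'.
by rewrite /polygon_length /= big_nat_recr//= big_nat1 /= fa fb.
Qed.

End curve_length.

(** * Segments of the K-plane *)

Section model_line.
Context {R : realType}.
Implicit Types K l x y : R.

Lemma acos_cos_abs x : `|x| <= pi -> acos (cos x) = `|x|.
Proof.
move=> xpi; have -> : cos x = cos `|x| by case: (ger0P x) => // _; rewrite cosN.
by rewrite cosK// in_itv/= normr_ge0.
Qed.

Definition coshR x : R := (expR x + expR (- x)) / 2.
Definition sinhR x : R := (expR x - expR (- x)) / 2.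

Lemma coshR_sqr x : coshR x ^+ 2 = 1 + sinhR x ^+ 2.
Proof.
have e : expR x * expR (- x) = 1 by rewrite -expRD subrr expR0.
by rewrite /coshR /sinhR; move: (expR x) (expR (- x)) e => u v; nra.
Qed.

Lemma coshRB x y : coshR x * coshR y - sinhR x * sinhR y = coshR (x - y).
Proof. by rewrite /coshR /sinhR opprB addrC !expRD; field. Qed.

Lemma arcosh_cosh x : arcosh (coshR x) = `|x|.
Proof.
rewrite /arcosh coshR_sqr (addrC 1) addrK sqrtr_sqr /coshR /sinhR.
have [x0|x0] := ger0P x.
  rewrite ger0_norm; last by rewrite divr_ge0// subr_ge0 ler_expR; lra.
  by rewrite -[RHS]expRK; congr ln; field.
rewrite ltr0_norm; last by rewrite pmulr_llt0 ?invr_gt0// subr_lt0 ltr_expR; lra.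
by rewrite -[RHS]expRK; congr ln; field.
Qed.

(** An arc of the half-circle, hyperbola or line cut out of the model by the plane y = 0,
    parametrized by length. The half-circle of the hemisphere has length pi / sqrt K, whence the
    bound on [l]. *)
Lemma kplane_line K l : 0 <= l -> (0 < K -> l * Num.sqrt K <= pi) ->
  exists h : R -> kplane K, forall s t, 0 <= s <= l -> 0 <= t <= l ->
    kplane_dist (h s) (h t) = `|s - t|.
Proof.
(* [c] clamps the parameter to [[0, l]], so that every value of [h] lies in the carrier, as its type
   demands. *)
move=> l0 lK; pose k := Num.sqrt `|K|; pose c s : R := Num.max 0 (Num.min s l).
have cs s : 0 <= s <= l -> c s = s.
  by move=> /andP[s0 sl]; rewrite /c (min_idPl sl) (max_idPr s0).
have c_ge0 s : 0 <= c s by rewrite /c le_max lexx.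
have c_le s : c s <= l by rewrite /c ge_max l0 ge_min lexx orbT.
pose p s : R * R * R :=
  if 0 < K then (cos (k * c s) / k, 0, sin (k * c s) / k)
  else if K < 0 then (sinhR (k * c s) / k, 0, coshR (k * c s) / k)
  else (c s, 0, 0).
have k2 : k ^+ 2 = `|K| by rewrite sqr_sqrtr.
have k_gt0 : K != 0 -> 0 < k by rewrite sqrtr_gt0 normr_gt0.
have pK s : kplane_carrier K (p s).
  rewrite /kplane_carrier /p /dot3 /minkowski3 /=.
  have [K0|K0] := ltP 0 K.
    have kp : 0 < k by rewrite k_gt0// gt_eqF.
    have eK : k = Num.sqrt K by rewrite /k gtr0_norm.
    rewrite /=; split.
      rewrite !mulr0 addr0 -!expr2 !expr_div_n -mulrDl cos2Dsin2 k2 gtr0_norm//.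
      by rewrite mul1r.
    rewrite divr_ge0 ?(ltW kp)// sin_ge0_pi// mulr_ge0 ?(ltW kp)//=.
    by rewrite (le_trans _ (lK K0))// mulrC eK ler_wpM2r.
  have [K1|K1] := ltP K 0; last by [].
  have kp : 0 < k by rewrite k_gt0// lt_eqF.
  rewrite /=; split.
    have -> : - K = k ^+ 2 by rewrite k2 ltr0_norm.
    rewrite !mulr0 subr0 -!expr2 !(expr_div_n _ k) -mulrBl.
    by rewrite -[in RHS](mul1r (k ^- 2)) -(addrK (sinhR (k * c s) ^+ 2) 1) -coshR_sqr.
  by rewrite divr_gt0// divr_gt0// addr_gt0 ?expR_gt0.
pose h s : kplane K := SigSub (mem_set (pK s)).
exists h => s t s0 t0; rewrite /kplane_dist /= /p !cs//.
have [K0|K0] := ltP 0 K.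
  have kp : 0 < k by rewrite k_gt0// gt_eqF.
  have eK : k = Num.sqrt K by rewrite /k gtr0_norm.
  have -> : K = k ^+ 2 by rewrite k2 gtr0_norm.
  rewrite /dot3/= sqrtr_sqr gtr0_norm//.
  have -> : k ^+ 2 * (cos (k * s) / k * (cos (k * t) / k) + 0 * 0 +
    sin (k * s) / k * (sin (k * t) / k)) = cos (k * (s - t)).
    by rewrite mulrBr cosB; field; rewrite gt_eqF.
  have nk : `|k * (s - t)| = k * `|s - t| by rewrite normrM gtr0_norm.
  rewrite acos_cos_abs nk; first by rewrite mulrC mulKf// gt_eqF.
  rewrite (le_trans _ (lK K0))// mulrC -eK ler_wpM2r ?(ltW kp)//.
  by rewrite ler_norml; lra.
have [K1|K1] := ltP K 0.
  have kp : 0 < k by rewrite k_gt0// lt_eqF.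
  have -> : - K = k ^+ 2 by rewrite k2 ltr0_norm.
  rewrite /minkowski3/= sqrtr_sqr gtr0_norm//.
  have -> : k ^+ 2 * (coshR (k * s) / k * (coshR (k * t) / k) -
    sinhR (k * s) / k * (sinhR (k * t) / k) - 0 * 0) = coshR (k * (s - t)).
    by rewrite [k * (s - t)]mulrBr -coshRB; field; rewrite gt_eqF.
  by rewrite arcosh_cosh normrM gtr0_norm// mulrC mulKf// gt_eqF.
by rewrite /dot3/= !subr0 !mulr0 !addr0 -expr2 sqrtr_sqr.
Qed.

End model_line.

Section RK_unique.
Context {R : realType} {T : Type} (d : T -> T -> R) (K : R).
Hypothesis d_refl : forall x, d x x = 0.
Hypothesis d_ge0 : forall x y, 0 <= d x y.
Hypothesis d_sym : forall x y, d x y = d y x.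
Hypothesis d_tri : forall x y z, d x z <= d x y + d y z.
Hypothesis RK : RK_domain d K.

(* Comparison with the degenerate triangle of a segment of the K-plane. *)
Lemma RK_domain_unique A B C D a b f : shortest_arc d A C a b f ->
  on_arc a b f D -> d A D = d A B -> d A B + d B C = d A C -> d B D = 0.
Proof.
move=> fAC fD AD AC; have [_ perim cmp] := RK.
have l0 := d_ge0 A C; have AB0 := d_ge0 A B; have BC0 := d_ge0 B C.
have lK : 0 < K -> d A C * Num.sqrt K <= pi.
  move=> K0; have sK0 : 0 < Num.sqrt K by rewrite sqrtr_gt0.
  (* The triangle A, A, C has perimeter twice the side AC. *)
  have := perim K0 A A C; rewrite d_refl add0r ltr_pdivlMr// => ?; lra.
have [h hl] := kplane_line l0 lK.
have h0 : 0 <= (0 : R) <= d A C by rewrite ?lexx ?l0.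
have h1 : 0 <= d A B <= d A C by apply/andP; split; lra.
have h2 : 0 <= d A C <= d A C by rewrite ?lexx ?l0.
apply/eqP; rewrite eq_le d_ge0 andbT.
(* [B] and [D] are equally far from [A], so both have [h (d A B)] as comparison point, and
   comparison bounds [d B D] by 0. *)
have -> : 0 = kplane_dist (h (d A B)) (h (d A B)) by rewrite hl// subrr normr0.
apply: (cmp A B C D a b f (h 0) _ (h (d A C)) _ 0 (d A C) h) => //.
- split; rewrite hl//.
  + by rewrite sub0r normrN ger0_norm.
  + by rewrite distrC ger0_norm; lra.
  + by rewrite sub0r normrN ger0_norm.
- have lin s t : 0 <= s -> s <= t -> t <= d A C ->
      kplane_dist (h s) (h t) = 1 * (t - s).
    move=> s0 st tl; rewrite hl; first by rewrite distrC ger0_norm; lra.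
      by apply/andP; split; lra.
    by apply/andP; split; lra.
  split => //; last first.
    by rewrite (isometric_curve_length l0 lin) mul1r subr0 hl// sub0r normrN ger0_norm.
  split=> // t; rewrite in_itv/= => tl.
  apply/cvgrPdist_lt => e e0; rewrite near_withinE; near=> s => sl.
  rewrite hl ?sub0r ?normrN ?normr_id; last 2 first.
  + by move: sl; rewrite /= in_itv.
  + by [].
  near: s; exists e => // s /=; by rewrite distrC.
- by exists (d A B) => //; rewrite in_itv.
- by rewrite hl// sub0r normrN ger0_norm.
Unshelve. all: by end_near. Qed.

(** The distance from [A] varies continuously along the arc, from 0 to [d A C]; additivity of length
    then gives the distance to [C]. *)
Lemma shortest_arc_point A C a b f v : shortest_arc d A C a b f ->
  0 <= v <= d A C ->
  exists D, [/\ on_arc a b f D, d A D = v & d D C = d A C - v].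
Proof.
move=> fAC /andP[v0 vl]; have [[ab fc] fa fb _] := fAC.
have cf : {within `[a, b], continuous (fun s => d A (f s))}.
  apply/subspace_continuousP => t tab; apply/cvgrPdist_lt => e e0.
  have := fc t tab; move=> /cvgrPdist_lt/(_ e e0).
  apply: filterS => s; rewrite sub0r normrN ger0_norm// => fst.
  have := d_tri A (f s) (f t); have := d_tri A (f t) (f s).
  rewrite (d_sym (f t)) => *; rewrite ltr_distl /from_subspace; apply/andP; split; lra.
have [|t tab tv] := IVT ab cf (v := v).
  by rewrite fa fb d_refl (min_idPl _) ?(max_idPr _) ?d_ge0// v0.
exists (f t); split => //; first by exists t.
have := shortest_arc_additive d_refl fAC tab; have := d_tri A (f t) C; lra.
Qed.

Lemma RK_domain_segment A C v : 0 <= v <= d A C ->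
  exists2 D, d A D = v /\ d D C = d A C - v &
    forall D', d A D' = v -> d D' C = d A C - v -> d D' D = 0.
Proof.
move=> vl; have [/(_ A C)[a [b [f fAC]]] _ _] := RK.
have [D [Df AD DC]] := shortest_arc_point fAC vl.
exists D => // D' AD' DC'; apply: (RK_domain_unique fAC Df); first by rewrite AD.
by rewrite AD' DC'; ring.
Qed.

End RK_unique.

Section geodesics.
Context {R : realType} (X : metricType R).
Local Notation d := (@mdist R X).
Implicit Types (x y z w : X) (s t r : R).

(** Arcs are replaced by their points, each determined by its distances to the two ends. In this
    form uniqueness concerns points of a compact space, and continuity follows without
    reparametrizing curves. *)
Definition uniquely_geodesic r := forall x y v, d x y < r -> 0 <= v <= d x y ->
  exists2 z, d x z = v /\ d z y = d x y - v &
    forall z', d x z' = v -> d z' y = d x y - v -> z' = z.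

(** [r] is a Lebesgue number of the cover by the given domains: each ball of radius [r] lies in one
    of them. *)
Lemma curvature_uniquely_geodesic K : compact [set: X] ->
  curvature_bounded_above X K -> exists2 r, 0 < r & uniquely_geodesic r.
Proof.
move=> cX curvK.
pose P (r : R) x := exists U : set X, RK_domain (@induced_dist R X U) K /\
  forall y, d x y < r -> U y.
have : \forall r \near (0 : R)^'+, [set: X] `<=` P r.
  move/compact_near_coveringP: cX; apply => x _.
  have [U xU RKU] := curvK x.
  have /metricType_numDomainType.nbhs_mdistP[e /= e0 eU] := xU.
  exists (ball x (e / 2), [set r : R | r <= e / 2]).
    split; first by apply: nbhsx_ballx; rewrite divr_gt0.
    by apply: nbhs_right_le; rewrite divr_gt0.
  move=> [y r] /= [+ re]; rewrite ballEmdist /= => xy; exists U; split => // z yz.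
  by apply: eU => /=; have := metric_triangle x y z; lra.
move=> rP; near (0 : R)^'+ => r.
have r0 : 0 < r by near: r; exact: nbhs_right_gt.
have rP' : [set: X] `<=` P r by near: r.
exists r => // x y v xyr vl.
have [U [RKU rU]] := rP' x I.
pose i z : U z -> set_type U := fun Uz => SigSub (mem_set Uz).
have Ux : U x by apply: rU; rewrite mdistxx.
have Uy : U y by exact: rU.
pose du := @induced_dist R X U.
have [] := @RK_domain_segment R _ du K _ _ _ _ RKU (i x Ux) (i y Uy) v.
- by move=> ?; exact: mdistxx.
- by move=> ??; exact: mdist_ge0.
- by move=> ??; exact: metric_sym.
- by move=> ???; exact: metric_triangle.
- by [].
move=> z [xz zy] uz; exists (\val z) => // z' xz' z'y.
(* Uniqueness in [U] is uniqueness in X: the distance [v < r] from [x] already puts [z'] in [U]. *)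
have Uz' : U z' by apply: rU; rewrite xz'; move: vl => /andP[_ /le_lt_trans]; exact.
by apply: mdist_positivity; exact: (uz (i z' Uz')).
Unshelve. all: by end_near. Qed.

End geodesics.

(** * The geodesic map *)

Section distance.
Context {R : realType} (X : metricType R).
Local Notation d := (@mdist R X).

Lemma mdist_distl (x y z : X) : `|d x z - d y z| <= d x y.
Proof.
have := metric_triangle x y z; have := metric_triangle y x z.
by rewrite (metric_sym y x) ler_distl => *; apply/andP; split; lra.
Qed.

Lemma mdist_distr (x y z : X) : `|d z x - d z y| <= d x y.
Proof. by rewrite !(metric_sym z) mdist_distl. Qed.

Lemma cvg_mdist T (F : set_system T) (FF : Filter F) (f g : T -> X) x y :
  f @ F --> x -> g @ F --> y -> d (f t) (g t) @[t --> F] --> d x y.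
Proof.
move=> fx gy; apply/cvgrPdist_lt => e e0; near=> t.
have ft : d x (f t) < e / 2.
  by near: t; apply: (metricType_numDomainType.cvgr_dist_lt fx); lra.
have gt : d y (g t) < e / 2.
  by near: t; apply: (metricType_numDomainType.cvgr_dist_lt gy); lra.
have := mdist_distl x (f t) y; have := mdist_distr y (g t) (f t).
have := ler_distD (d (f t) y) (d x y) (d (f t) (g t)); lra.
Unshelve. all: by end_near. Qed.

(** Used to glue two formulas that meet at a point, without describing where each of them is in
    force. *)
Lemma cvg_alternative T (F : set_system T) (FF : Filter F) (f g h : T -> X) (x : X) :
  g @ F --> x -> h @ F --> x -> (\forall t \near F, f t = g t \/ f t = h t) ->
  f @ F --> x.
Proof.
move=> gx hx fgh; apply/metricType_numDomainType.cvgrPdist_lt => e e0; near=> t.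
have gt : d x (g t) < e by near: t; exact: (metricType_numDomainType.cvgr_dist_lt gx).
have ht : d x (h t) < e by near: t; exact: (metricType_numDomainType.cvgr_dist_lt hx).
by have [->|->] : f t = g t \/ f t = h t by near: t.
Unshelve. all: by end_near. Qed.

End distance.

Section clamp.
Context {R : realType}.
Implicit Types s t : R.

Definition clamp t : R := Num.max 0 (Num.min t 1).

Lemma clamp_itv t : 0 <= clamp t <= 1.
Proof. by rewrite /clamp le_max lexx/= ge_max ler01/= ge_min lexx orbT. Qed.

Lemma clamp_id t : 0 <= t <= 1 -> clamp t = t.
Proof. by move=> /andP[t0 t1]; rewrite /clamp (min_idPl t1) (max_idPr t0). Qed.

Lemma clamp_le0 t : t <= 0 -> clamp t = 0.
Proof. by move=> t0; rewrite /clamp (min_idPl _) ?(max_idPl _)//; lra. Qed.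

Lemma clamp_ge1 t : 1 <= t -> clamp t = 1.
Proof. by move=> t1; rewrite /clamp (min_idPr t1) (max_idPr ler01). Qed.

Lemma clamp_lipschitz s t : `|clamp s - clamp t| <= `|s - t|.
Proof.
have cP u : [\/ u <= 0 /\ clamp u = 0, 1 <= u /\ clamp u = 1
    | 0 <= u <= 1 /\ clamp u = u].
  have [u0|u0] := leP u 0; first by constructor 1; rewrite clamp_le0.
  have [u1|u1] := leP 1 u; first by constructor 2; rewrite clamp_ge1.
  have h : 0 <= u <= 1 by rewrite !ltW.
  by constructor 3; rewrite clamp_id.
case: (cP s) => -[+ ->]; case: (cP t) => -[+ ->]; (try move=> /andP[]); intros;
  (try match goal with H : is_true (_ && _) |- _ => move/andP: H => [? ?] end);
  rewrite ler_norml; have := ler_norm (s - t); have := ler_norm (- (s - t));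
  rewrite normrN => *; apply/andP; split; lra.
Qed.

Lemma cvg_clamp T (F : set_system T) (FF : Filter F) (f : T -> R) t :
  f @ F --> t -> clamp (f x) @[x --> F] --> clamp t.
Proof.
move=> /cvgrPdist_lt ft; apply/cvgrPdist_lt => e e0; apply: filterS (ft e e0) => x.
exact: le_lt_trans (clamp_lipschitz _ _).
Qed.

End clamp.

Section geodesic_map.
Context {R : realType} (X : metricType R) (r : R).
Local Notation d := (@mdist R X).
Implicit Types (x y z w : X) (s t : R).
Hypothesis cX : compact [set: X].
Hypothesis ug : uniquely_geodesic X r.

(** The value is meaningful for [d x y < r]. The clamp freezes the curve at its ends, so that every
    real parameter is allowed. *)
Definition geod x y t : X :=
  xget x [set z | d x z = clamp t * d x y /\ d z y = (1 - clamp t) * d x y].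

Lemma geod_spec x y t : d x y < r ->
  [/\ d x (geod x y t) = clamp t * d x y, d (geod x y t) y = (1 - clamp t) * d x y
    & forall z, d x z = clamp t * d x y -> d z y = (1 - clamp t) * d x y ->
      z = geod x y t].
Proof.
move=> xyr; have /andP[c0 c1] := clamp_itv t; have xy0 := mdist_ge0 x y.
have vI : 0 <= clamp t * d x y <= d x y.
  by rewrite mulr_ge0//= -[leRHS]mul1r ler_wpM2r.
have [z [xz zy] uz] := ug xyr vI.
have e : d x y - clamp t * d x y = (1 - clamp t) * d x y by ring.
rewrite e in zy uz.
have [gx gy] : d x (geod x y t) = clamp t * d x y /\
    d (geod x y t) y = (1 - clamp t) * d x y.
  exact: (@xgetPex X x [set z | d x z = clamp t * d x y /\
    d z y = (1 - clamp t) * d x y] (ex_intro _ z (conj xz zy))).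
by split => // z' xz' z'y; rewrite (uz _ gx gy) (uz z').
Qed.

Lemma geod_distl x y t : d x y < r -> d x (geod x y t) = clamp t * d x y.
Proof. by move=> /(geod_spec t)[]. Qed.

Lemma geod_distr x y t : d x y < r -> d (geod x y t) y = (1 - clamp t) * d x y.
Proof. by move=> /(geod_spec t)[]. Qed.

Lemma geod_le0 x y t : d x y < r -> t <= 0 -> geod x y t = x.
Proof.
move=> xyr t0; apply/esym/mdist_positivity.
by rewrite geod_distl// clamp_le0// mul0r.
Qed.

Lemma geod_ge1 x y t : d x y < r -> 1 <= t -> geod x y t = y.
Proof.
by move=> xyr t1; apply/mdist_positivity; rewrite geod_distr// clamp_ge1// subrr mul0r.
Qed.

Lemma geodxx x t : 0 < r -> geod x x t = x.
Proof.
move=> r0; apply/esym/mdist_positivity; rewrite geod_distl ?mdistxx ?mulr0//.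
Qed.

Lemma geod_distl_le x y t : d x y < r -> d x (geod x y t) <= d x y.
Proof.
move=> xyr; rewrite geod_distl// -[leRHS]mul1r ler_wpM2r ?mdist_ge0//.
by have /andP[] := clamp_itv t.
Qed.

Lemma geod_distr_le x y t : d x y < r -> d (geod x y t) y <= d x y.
Proof.
move=> xyr; rewrite geod_distr// -[leRHS]mul1r ler_wpM2r ?mdist_ge0//.
by have /andP[] := clamp_itv t; lra.
Qed.

(** An initial piece of a geodesic is a geodesic: the point [w] at fraction [s / t] between [x] and
    [geod x y t] has, by the triangle inequality, the two distances that characterize
    [geod x y s]. *)
Lemma geod_dist x y s t : d x y < r -> 0 <= s -> s <= t -> t <= 1 ->
  d (geod x y s) (geod x y t) = (t - s) * d x y.
Proof.
move=> xyr s0 st t1.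
have [t_eq0|t_neq0] := eqVneq t 0.
  by (have -> : s = t by lra); rewrite mdistxx subrr mul0r.
have t0 : 0 < t by rewrite lt_neqAle eq_sym t_neq0 (le_trans s0).
have cs : clamp s = s by rewrite clamp_id// s0 (le_trans st).
have ct : clamp t = t by rewrite clamp_id// t1 ltW.
have st1 : clamp (s / t) = s / t.
  by rewrite clamp_id// divr_ge0 ?(ltW t0)//= ler_pdivrMr// mul1r.
have xy0 := mdist_ge0 x y.
have xt : d x (geod x y t) = t * d x y by rewrite geod_distl// ct.
have xtr : d x (geod x y t) < r by apply: (le_lt_trans _ xyr); exact: geod_distl_le.
set w := geod x (geod x y t) (s / t).
have xw : d x w = s * d x y by rewrite geod_distl// st1 xt mulrA divfK.
have wt : d w (geod x y t) = (t - s) * d x y.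
  by rewrite geod_distr// st1 xt mulrA mulrBl mul1r divfK.
have ty : d (geod x y t) y = (1 - t) * d x y by rewrite geod_distr// ct.
have [_ _ uw] := geod_spec s xyr.
suff -> : geod x y s = w by [].
apply/esym/uw; rewrite cs//.
have := metric_triangle x w y; have := metric_triangle w (geod x y t) y.
by rewrite xw wt ty; lra.
Qed.

(** Uniqueness made quantitative by compactness: a point other than the geodesic point has a
    positive defect [q], and its neighbours have defects bounded below. Continuity of the geodesic
    map rests on this. *)
Lemma geod_approx x y t e : d x y < r -> 0 < e -> exists2 c, 0 < c &
  forall z, `|d x z - clamp t * d x y| < c ->
    `|d z y - (1 - clamp t) * d x y| < c -> d (geod x y t) z < e.
Proof.
move=> xyr e0; have [_ _ ugz] := geod_spec t xyr.
set a := clamp t * _ in ugz *; set b := (1 - _) * _ in ugz *.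
pose P (c : R) z := `|d x z - a| < c -> `|d z y - b| < c -> d (geod x y t) z < e.
have : \forall c \near (0 : R)^'+, [set: X] `<=` P c.
  move/compact_near_coveringP: cX; apply => z _.
  have [zE|zN] := eqVneq z (geod x y t).
    exists (ball z e, setT) => /=; first by split; [exact: nbhsx_ballx|exact: filterT].
    by move=> [w c] /= [+ _]; rewrite ballEmdist/= zE => zw _ _.
  pose q := `|d x z - a| + `|d z y - b|.
  have q0 : 0 < q.
    rewrite lt_neqAle addr_ge0// andbT eq_sym; apply/eqP => q0.
    move/eqP: zN; apply; apply: ugz; apply/eqP; rewrite -subr_eq0 -normr_le0.
      by have := normr_ge0 (d z y - b); rewrite /q in q0; lra.
    by have := normr_ge0 (d x z - a); rewrite /q in q0; lra.
  (* Moving [z] by less than [q / 4] changes each of the two distances by less than [q / 4]; with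
     [c <= q / 4] the defect of [z] would stay below [q]. *)
  exists (ball z (q / 4), [set c | c <= q / 4]) => /=.
    split; first by apply: nbhsx_ballx; lra.
    by apply: nbhs_right_le; lra.
  move=> [w c] /= [+ cq]; rewrite ballEmdist/= => zw xw wy; exfalso.
  have := ler_distD (d x w) (d x z) a; have := ler_distD (d w y) (d z y) b.
  have := mdist_distr z w x; have := mdist_distl z w y.
  by rewrite /q in q0 cq zw *; lra.
move=> cP; near (0 : R)^'+ => c.
have cP' : [set: X] `<=` P c by near: c.
by exists c => [|z]; [near: c; exact: nbhs_right_gt|exact: cP'].
Unshelve. all: by end_near. Qed.

Lemma cvg_geod T (F : set_system T) (FF : Filter F) (f g : T -> X) (h : T -> R) x y t :
  d x y < r -> f @ F --> x -> g @ F --> y -> h @ F --> t ->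
  geod (f u) (g u) (h u) @[u --> F] --> geod x y t.
Proof.
move=> xyr fx gy ht; apply/metricType_numDomainType.cvgrPdist_lt => e e0.
have [c c0 xytc] := geod_approx t xyr e0.
have fg := cvg_mdist FF fx gy; have ch := cvg_clamp FF ht.
have c1 : clamp (h u) * d (f u) (g u) @[u --> F] --> clamp t * d x y by exact: cvgM.
have c2 : (1 - clamp (h u)) * d (f u) (g u) @[u --> F] --> (1 - clamp t) * d x y.
  by apply: cvgM => //; apply: cvgB => //; exact: cvg_cst.
have c20 : 0 < c / 2 by lra.
near=> u; apply: xytc.
- have fu : d (f u) (g u) < r by near: u; exact: cvgr_lt fg _ xyr.
  have e1 : d x (f u) < c / 2.
    by near: u; apply: (metricType_numDomainType.cvgr_dist_lt fx).
  have e2 : `|clamp t * d x y - clamp (h u) * d (f u) (g u)| < c / 2.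
    by near: u; move/cvgrPdist_lt: c1; apply.
  have := mdist_distl x (f u) (geod (f u) (g u) (h u)).
  rewrite distrC in e2; rewrite [d (f u) (geod _ _ _)]geod_distl// => e3.
  have := ler_distD (clamp (h u) * d (f u) (g u))
    (d x (geod (f u) (g u) (h u))) (clamp t * d x y); lra.
- have fu : d (f u) (g u) < r by near: u; exact: cvgr_lt fg _ xyr.
  have e1 : d y (g u) < c / 2.
    by near: u; apply: (metricType_numDomainType.cvgr_dist_lt gy).
  have e2 : `|(1 - clamp t) * d x y - (1 - clamp (h u)) * d (f u) (g u)| < c / 2.
    by near: u; move/cvgrPdist_lt: c2; apply.
  have := mdist_distr y (g u) (geod (f u) (g u) (h u)).
  rewrite distrC in e2; rewrite [d (geod _ _ _) (g u)]geod_distr// => e3.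
  have := ler_distD ((1 - clamp (h u)) * d (f u) (g u))
    (d (geod (f u) (g u) (h u)) y) ((1 - clamp t) * d x y); lra.
Unshelve. all: by end_near. Qed.

End geodesic_map.

(** * Closed polygons and their midpoints *)

Section polygons.
Context {R : realType} (X : metricType R) (r : R).
Local Notation d := (@mdist R X).
Implicit Types (x y : int -> X) (s t : R) (i j : int) (N n : nat).
Hypothesis cX : compact [set: X].
Hypothesis ug : uniquely_geodesic X r.
Hypothesis r0 : 0 < r.

(* A closed N-gon is an N-periodic sequence of vertices; it is parametrized
   by R, the i-th edge being the image of [i, i + 1]. *)
Definition ngon N x :=
  (forall i, x (i + N%:Z) = x i) /\ (forall i, d (x i) (x (i + 1)) <= r / 4).

Definition polyline x s : X :=
  let i := Num.floor s in geod (x i) (x (i + 1)) (s - i%:~R).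

Definition midpoints x i : X := geod (x i) (x (i + 1)) 2^-1.

Definition energy N x : R := \sum_(0 <= i < N) d (x i%:Z) (x (i%:Z + 1)) ^+ 2.

Lemma intrS1 i : (i + 1)%:~R = i%:~R + 1 :> R.
Proof. by rewrite intrD. Qed.

Lemma intrB1 i : (i - 1)%:~R = i%:~R - 1 :> R.
Proof. by rewrite intrB. Qed.

(** [Num.floor] assigns a vertex to the edge that starts there; consecutive edges agree at their
    common vertex, so the formula of edge [i] holds on the closed interval. *)
Lemma polyline_edge x i s : (forall j, d (x j) (x (j + 1)) < r) ->
  i%:~R <= s <= i%:~R + 1 -> polyline x s = geod (x i) (x (i + 1)) (s - i%:~R).
Proof.
move=> xr /andP[is1 si1]; have [si|is2] := ltP s (i%:~R + 1).
  by rewrite /polyline (@floor_def _ _ i)// is1 intrS1.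
have -> : s = (i + 1)%:~R by rewrite intrS1; apply/eqP; rewrite eq_le si1.
rewrite /polyline intrKfloor subrr (geod_le0 ug)// intrS1.
by rewrite (addrC i%:~R) addrK (geod_ge1 ug).
Qed.

Lemma polyline_vertex x s : (forall j, d (x j) (x (j + 1)) < r) ->
  d (x (Num.floor s)) (polyline x s) <= d (x (Num.floor s)) (x (Num.floor s + 1)).
Proof. by move=> xr; exact: (geod_distl_le ug). Qed.

Lemma polyline_vertex1 x s : (forall j, d (x j) (x (j + 1)) < r) ->
  d (polyline x s) (x (Num.floor s + 1)) <= d (x (Num.floor s)) (x (Num.floor s + 1)).
Proof. by move=> xr; exact: (geod_distr_le ug). Qed.

Lemma polyline_periodic N x s : (forall i, x (i + N%:Z) = x i) ->
  polyline x (s + N%:R) = polyline x s.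
Proof.
move=> xN; rewrite /polyline floorDrz ?natr_int//.
have -> : Num.floor (N%:R : R) = N%:Z by rewrite -[N%:R]/(N%:Z%:~R) intrKfloor.
rewrite xN addrAC xN; congr geod.
by rewrite intrD -[N%:Z%:~R]/(N%:R : R); ring.
Qed.

(** One index [k] serves all offsets [j], so that an edge and the following one are moved together
    into a single period. *)
Lemma periodic_int N x : (0 < N)%N -> (forall i, x (i + N%:Z) = x i) ->
  forall i, exists2 k : nat, (k < N)%N & forall j, x (i + j) = x (k%:Z + j).
Proof.
move=> N0 xN i; have pern (m : nat) j : x (j + N%:Z * m%:Z) = x j.
  elim: m j => [|m IH] j; first by rewrite mulr0 addr0.
  by rewrite intS mulrDr mulr1 addrA IH xN.
have per k j : x (j + N%:Z * k) = x j.
  case: k => m; first exact: pern.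
  by rewrite NegzE mulrN -[in RHS](subrK (N%:Z * m.+1%:Z) j) pern.
have N0' : N%:Z != 0 by rewrite eqz_nat -lt0n.
have mN : (`|(i %% N%:Z)%Z| < N)%N.
  by rewrite -ltz_nat gez0_abs ?modz_ge0// ltz_pmod.
exists `|(i %% N%:Z)%Z|%N => // j.
have {1}-> : i = `|(i %% N%:Z)%Z|%:Z + N%:Z * (i %/ N%:Z)%Z.
  by rewrite gez0_abs ?modz_ge0// addrC mulrC -divz_eq.
by rewrite addrAC per.
Qed.

Lemma ngon_lt N x i : ngon N x -> d (x i) (x (i + 1)) < r.
Proof. by move=> [_ xe]; apply: le_lt_trans (xe i) _; have := r0; lra. Qed.

(** At an integer [s] the floor of [f t] may alternate between two values; the formulas of the two
    edges at this vertex have the same limit. *)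
Lemma cvg_polyline T (F : set_system T) (FF : Filter F) (y : T -> int -> X) x
    (f : T -> R) s :
  (forall j, d (x j) (x (j + 1)) < r) -> (forall (t : T) j, d (y t j) (y t (j + 1)) < r) ->
  (forall i, y t i @[t --> F] --> x i) -> f @ F --> s ->
  polyline (y t) (f t) @[t --> F] --> polyline x s.
Proof.
move=> xr yr yx fs; set i := Num.floor s.
have /andP[is1 si1] := floor_itv s; rewrite -/i intrS1 in is1 si1.
have fi j : f t - j%:~R @[t --> F] --> s - j%:~R by apply: cvgB => //; exact: cvg_cst.
have edge j : geod (y t j) (y t (j + 1)) (f t - j%:~R) @[t --> F]
    --> geod (x j) (x (j + 1)) (s - j%:~R).
  exact: (cvg_geod cX ug).
have f_lt : \forall t \near F, f t < i%:~R + 1 by exact: cvgr_lt fs _ _.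
have [si|is2] := eqVneq s i%:~R; last first.
  have f_gt : \forall t \near F, i%:~R < f t.
    by apply: cvgr_gt fs _ _; rewrite lt_neqAle eq_sym is2.
  apply: cvg_trans (edge i); apply: near_eq_cvg; near=> t; apply/esym/polyline_edge => //.
  by apply/andP; split; apply: ltW; near: t.
have f_gt : \forall t \near F, i%:~R - 1 < f t by apply: cvgr_gt fs _ _; lra.
pose g (t : T) := geod (y t i) (y t (i + 1)) (f t - i%:~R).
pose h (t : T) := geod (y t (i - 1)) (y t (i - 1 + 1)) (f t - (i - 1)%:~R).
apply: (cvg_alternative FF (g := g) (h := h)).
- exact: edge.
- have -> : polyline x s = geod (x (i - 1)) (x (i - 1 + 1)) (s - (i - 1)%:~R).
    by apply: polyline_edge => //; rewrite intrB1; apply/andP; split; lra.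
  exact: edge.
- near=> t; have f1 : f t < i%:~R + 1 by near: t.
  have f2 : i%:~R - 1 < f t by near: t.
  have [ft|ft] := leP i%:~R (f t); [left|right]; apply: polyline_edge => //.
    by rewrite ft ltW.
  by rewrite intrB1; apply/andP; split; lra.
Unshelve. all: by end_near. Qed.

Lemma half_itv : 0 <= (2^-1 : R) <= 1.
Proof. by apply/andP; split; lra. Qed.

Lemma midpoints_distl x i : d (x i) (x (i + 1)) < r ->
  d (x i) (midpoints x i) = d (x i) (x (i + 1)) / 2.
Proof.
by move=> xr; rewrite (geod_distl ug)// (clamp_id half_itv) mulrC.
Qed.

Lemma midpoints_distr x i : d (x i) (x (i + 1)) < r ->
  d (midpoints x i) (x (i + 1)) = d (x i) (x (i + 1)) / 2.
Proof.
by move=> xr; rewrite (geod_distr ug)// (clamp_id half_itv); field.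
Qed.

Lemma midpoints_edge x i : (forall j, d (x j) (x (j + 1)) < r) ->
  d (midpoints x i) (midpoints x (i + 1)) <=
    (d (x i) (x (i + 1)) + d (x (i + 1)) (x (i + 1 + 1))) / 2.
Proof.
move=> xr; have := metric_triangle (midpoints x i) (x (i + 1)) (midpoints x (i + 1)).
by rewrite midpoints_distr// midpoints_distl//; lra.
Qed.

Lemma ngon_midpoints N x : ngon N x -> ngon N (midpoints x).
Proof.
move=> xN; have [xp xe] := xN; split=> i; first by rewrite /midpoints xp addrAC xp.
have := midpoints_edge i (fun j => ngon_lt j xN).
by have := xe i; have := xe (i + 1); lra.
Qed.

Lemma sum_shift (f : nat -> R) N : f N = f 0%N ->
  \sum_(0 <= i < N) f i.+1 = \sum_(0 <= i < N) f i.
Proof.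
move=> fN; apply/eqP; rewrite -subr_eq0 -sumrB (telescope_sumr f)//.
by rewrite fN subrr.
Qed.

(** Each edge is shared equally between its two ends; in this form the energy can be compared with
    that of the midpoints corner by corner. *)
Lemma energy_midpoints_sum N x : ngon N x ->
  energy N x = \sum_(0 <= i < N)
    (d (x i%:Z) (x (i%:Z + 1)) ^+ 2 + d (x (i%:Z + 1)) (x (i%:Z + 1 + 1)) ^+ 2) / 2.
Proof.
move=> [xp _]; rewrite -mulr_suml big_split/=.
have -> : \sum_(0 <= i < N) d (x (i%:Z + 1)) (x (i%:Z + 1 + 1)) ^+ 2 = energy N x.
  pose f (i : nat) := d (x i%:Z) (x (i%:Z + 1)) ^+ 2.
  rewrite /energy -[RHS](sum_shift (f := f)).
    by apply: eq_big_nat => i _; rewrite /f intS addrC.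
  have := xp 0; rewrite add0r /f => ->; have := xp 1; rewrite addrC => ->.
  by rewrite add0r.
by rewrite -/(energy N x); field.
Qed.

(** Triangle inequality at the corner, then convexity of the square. Equality forces both to be
    equalities: strict convexity gives equal edges, and the edge between midpoints is then as long
    as they are. *)
Lemma energy_midpoints_term x i : (forall j, d (x j) (x (j + 1)) < r) ->
  d (midpoints x i) (midpoints x (i + 1)) ^+ 2 <=
  (d (x i) (x (i + 1)) ^+ 2 + d (x (i + 1)) (x (i + 1 + 1)) ^+ 2) / 2 ?=
    iff (d (x i) (x (i + 1)) == d (x (i + 1)) (x (i + 1 + 1))) &&
        (d (midpoints x i) (midpoints x (i + 1)) == d (x i) (x (i + 1))).
Proof.
move=> xr; have := midpoints_edge i xr.
have := mdist_ge0 (midpoints x i) (midpoints x (i + 1)).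
have := mdist_ge0 (x i) (x (i + 1)); have := mdist_ge0 (x (i + 1)) (x (i + 1 + 1)).
move: (d (midpoints _ _) _) (d _ (x (i + 1))) (d (x (i + 1)) _) => b a a' a'0 a0 b0 bl.
have aa : 0 <= (a - a') ^+ 2 by exact: sqr_ge0.
have bb : b ^+ 2 <= ((a + a') / 2) ^+ 2 by rewrite lerXn2r ?nnegrE//; lra.
split; first by nra.
apply/eqP/andP => [e|[/eqP <- /eqP ->]]; last by field.
have a_eq : a = a'.
  by apply/eqP; rewrite -subr_eq0 -sqrf_eq0 eq_le aa andbT; nra.
by split; apply/eqP => //; subst a'; apply/eqP; rewrite -(@eqrXn2 _ 2)// e; apply/eqP; field.
Qed.

Lemma energy_midpoints N x : ngon N x -> energy N (midpoints x) <= energy N x.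
Proof.
move=> xN; rewrite [leRHS](energy_midpoints_sum xN); apply: ler_sum_nat => i _.
exact: (energy_midpoints_term _ (fun j => ngon_lt j xN)).1.
Qed.

Lemma energy_midpoints_eq N x : ngon N x -> (0 < N)%N ->
  energy N (midpoints x) = energy N x -> exists l, forall i,
    d (x i) (x (i + 1)) = l /\ d (midpoints x i) (midpoints x (i + 1)) = l.
Proof.
move=> xN N0 EE; have xr j := ngon_lt j xN.
have eqi (i : nat) : (i < N)%N ->
    d (x i%:Z) (x (i%:Z + 1)) = d (x (i%:Z + 1)) (x (i%:Z + 1 + 1)) /\
    d (midpoints x i%:Z) (midpoints x (i%:Z + 1)) = d (x i%:Z) (x (i%:Z + 1)).
  move=> iN; pose F j := energy_midpoints_term j xr.
  have := leif_sum (fun (j : 'I_N) (_ : true) => F (j : nat)%:Z).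
  have <- : energy N (midpoints x) =
    \sum_(j < N) d (midpoints x j%:Z) (midpoints x (j%:Z + 1)) ^+ 2.
    by rewrite /energy big_mkord.
  have <- : energy N x = \sum_(j < N) (d (x j%:Z) (x (j%:Z + 1)) ^+ 2 +
    d (x (j%:Z + 1)) (x (j%:Z + 1 + 1)) ^+ 2) / 2.
    by rewrite energy_midpoints_sum// big_mkord.
  by case=> _; rewrite EE eqxx => /esym/forallP/(_ (Ordinal iN))
    /andP[/eqP ? /eqP ?].
have eql (i : nat) : (i <= N)%N -> d (x i%:Z) (x (i%:Z + 1)) = d (x 0) (x (0 + 1)).
  elim: i => [//|i IH iN]; rewrite -IH; last exact: ltnW.
  by have [-> _] := eqi _ iN; rewrite intS addrC.
exists (d (x 0) (x (0 + 1))) => i.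
have [k kN xE] := periodic_int N0 xN.1 i.
have := xE 0; rewrite !addr0 => xE0; have [e1 e2] := eqi _ kN.
have xE1 := xE 1; have := xE (1 + 1); rewrite !addrA => xE2.
by rewrite /midpoints in e2 *; rewrite xE0 xE1 xE2 e2 eql// ltnW.
Qed.

(** When the energy does not drop, the path from a midpoint to the next through a vertex realizes
    their distance: the polygon is straight at its vertices. As all edges have the same length, it
    is isometric, up to the speed, at the scale of half an edge. *)
Lemma ngon_closed_geodesic N x : ngon N x -> (0 < N)%N ->
  energy N (midpoints x) = energy N x -> energy N x != 0 ->
  exists g : R -> X, closed_geodesic g /\ ~ constant_curve g.
Proof.
move=> xN N0 EE Ex; have xr j := ngon_lt j xN.
have [l le] := energy_midpoints_eq xN N0 EE.
have l0 : 0 < l.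
  rewrite lt_neqAle -(le 0).1 mdist_ge0 andbT; apply: contra Ex => /eqP l0.
  by rewrite /energy big1// => i _; rewrite (le i%:Z).1 -(le 0).1 -l0 expr0n.
have iso s t : s <= t -> t - s <= 2^-1 -> d (polyline x s) (polyline x t) = l * (t - s).
  move=> st ts; set i := Num.floor s.
  have /andP[is1 si1] := floor_itv s; rewrite -/i intrS1 in is1 si1.
  rewrite [polyline x s](@polyline_edge x i)//; last by rewrite is1 ltW.
  have [ti|it] := leP t (i%:~R + 1).
    rewrite [polyline x t](@polyline_edge x i)//; last by rewrite ti (le_trans is1).
    by rewrite (geod_dist ug)// ?(le i).1; [ring|lra|lra|lra].
  rewrite [polyline x t](@polyline_edge x (i + 1))//; last first.
    by rewrite intrS1; apply/andP; split; lra.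
  set u := s - i%:~R; set v := t - (i + 1)%:~R.
  have v_eq : v = t - i%:~R - 1 by rewrite /v intrS1; ring.
  have e1 : d (geod (x i) (x (i + 1)) u) (x (i + 1)) = l * (1 - u).
    by rewrite (geod_distr ug)// (le i).1 clamp_id; [ring|]; apply/andP; split; rewrite /u; lra.
  have e2 : d (x (i + 1)) (geod (x (i + 1)) (x (i + 1 + 1)) v) = l * v.
    by rewrite (geod_distl ug)// (le (i + 1)).1 clamp_id; [ring|]; apply/andP; split; lra.
  have e3 : d (midpoints x i) (geod (x i) (x (i + 1)) u) = l * (u - 2^-1).
    by rewrite (geod_dist ug)// ?(le i).1; [ring|rewrite /u; lra..].
  have e4 : d (geod (x (i + 1)) (x (i + 1 + 1)) v) (midpoints x (i + 1)) = l * (2^-1 - v).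
    by rewrite (geod_dist ug)// ?(le (i + 1)).1; [ring|lra..].
  (* A shortcut across the corner would also shorten the path between the two adjacent midpoints,
     whose distance is [l]. The bound [t - s <= 2^-1] places both points between these midpoints. *)
  have := metric_triangle (geod (x i) (x (i + 1)) u) (x (i + 1))
    (geod (x (i + 1)) (x (i + 1 + 1)) v).
  have := metric_triangle (midpoints x i) (geod (x i) (x (i + 1)) u) (midpoints x (i + 1)).
  have := metric_triangle (geod (x i) (x (i + 1)) u)
    (geod (x (i + 1)) (x (i + 1 + 1)) v) (midpoints x (i + 1)).
  rewrite e1 e2 e3 e4 (le i).2 => i1 i2 i3.
  apply/eqP; rewrite eq_le; apply/andP; split.
    by apply: (le_trans i3); rewrite v_eq /u; lra.
  by rewrite v_eq /u in i1 i2 *; lra.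
(* [c] fits the [N] edges into a period 2 pi; the later [h] is the parameter length of half an
   edge. *)
pose c : R := N%:R / (2 * pi); have pi0 := pi_gt0 R.
have c0 : 0 < c by rewrite divr_gt0 ?ltr0n// mulr_gt0.
pose g t := polyline x (c * t); pose h := (2 * c)^-1.
have h0 : 0 < h by rewrite invr_gt0 mulr_gt0.
have giso s t : s <= t -> t - s <= h -> d (g s) (g t) = l * c * (t - s).
  move=> st ts; rewrite /g iso; first by ring.
    by rewrite ler_pM2l.
  have := ler_wpM2l (ltW c0) ts; rewrite /h invfM mulrCA divff ?gt_eqF//; lra.
have tri (a b e : X) : d a e <= d a b + d b e by exact: metric_triangle.
have refl (a : X) : d a a = 0 by exact: mdistxx.
have lip := local_isometry_lipschitz tri refl h0 giso.
have lc0 : 0 < l * c by exact: mulr_gt0.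
have gc : continuous g.
  move=> t; apply/metricType_numDomainType.cvgrPdist_lt => e e0; near=> s.
  have ts : `|t - s| < e / (l * c).
    by near: s; apply: (@cvgr_dist_lt _ _ _ _ _ id t); [exact: cvg_id|exact: divr_gt0].
  rewrite ltr_pdivlMr// mulrC in ts.
  have [st|st] := leP s t.
    by rewrite metric_sym (le_lt_trans (lip _ _ st))// -[t - s]ger0_norm// subr_ge0.
  by rewrite (le_lt_trans (lip _ _ (ltW st)))// -[s - t]gtr0_norm ?subr_gt0// distrC.
have len a b : a <= b -> curve_length d a b g = (l * c * (b - a))%:E.
  exact: (local_isometry_curve_length tri refl h0 giso).
exists g; split; last first.
  move=> [y gy]; have := giso 0 h (ltW h0); rewrite !gy mdistxx subr0 lexx => /(_ isT)/esym/eqP.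
  by rewrite mulf_eq0 !gt_eqF.
split.
- split=> // t; rewrite /g mulrDr -[in RHS](polyline_periodic _ xN.1); congr polyline.
  by rewrite /c divfK// gt_eqF// mulr_gt0.
- by exists (l * c).
- move=> t; exists (h / 2); first by rewrite divr_gt0.
  have tt : t - h / 2 <= t + h / 2 by lra.
  split => //; last by rewrite len// giso//; lra.
  split=> // s; rewrite in_itv/= => _; have : d (g u) (g s) @[u --> s] --> d (g s) (g s).
    by apply: cvg_mdist; [exact: gc|exact: cvg_cst].
  by rewrite mdistxx; exact: cvg_within_filter.
Unshelve. all: by end_near. Qed.

End polygons.

(** * Uniform shortening of N-gons *)

Section shortening.
Context {R : realType} (X : metricType R) (r : R).
Local Notation d := (@mdist R X).
Implicit Types (x y : int -> X) (s t : R) (i j : int) (N n : nat).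
Hypothesis cX : compact [set: X].
Hypothesis ug : uniquely_geodesic X r.
Hypothesis r0 : 0 < r.
Hypothesis nogeod : forall g : R -> X, closed_geodesic g -> constant_curve g.

Local Notation polygons := (prod_topology (fun _ : int => X)).

Lemma cvg_proj (x : polygons) i : (y i) @[y --> x] --> x i.
Proof. exact: (@proj_continuous _ (fun _ : int => X) i x). Qed.

Lemma cvg_energy T (F : set_system T) (FF : Filter F) N (y : T -> int -> X) x :
  (forall i, y t i @[t --> F] --> x i) ->
  energy N (y t) @[t --> F] --> energy N x.
Proof.
move=> yx; rewrite /energy; elim: N => [|N IH].
  under eq_fun do rewrite big_nil; rewrite big_nil; exact: cvg_cst.
under eq_fun do rewrite big_nat_recr//=; rewrite big_nat_recr//=.
by apply: cvgD => //; rewrite expr2; under eq_fun do rewrite expr2;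
  apply: cvgM; apply: cvg_mdist.
Qed.

Lemma continuous_energy N : continuous (fun x : polygons => energy N x).
Proof.
by move=> x; apply: (@cvg_energy _ (nbhs x) _ N id) => i; exact: cvg_proj.
Qed.

Lemma closed_dist_le i j c : closed [set x : polygons | d (x i) (x j) <= c].
Proof.
have -> : [set x : polygons | d (x i) (x j) <= c] =
  (fun x : polygons => d (x i) (x j)) @^-1` [set u | u <= c] by [].
apply: closed_comp; last exact: closed_le.
move=> x _; have : d (y i) (y j) @[y --> (x : polygons)] --> d (x i) (x j).
  exact: (@cvg_mdist _ _ _ (nbhs (x : polygons)) _ _ _ _ _ (@cvg_proj x i) (@cvg_proj x j)).
exact.
Qed.

(** Tychonoff over all integer indices: periodicity, rewritten as a distance at most 0, and the
    non-strict bound [r / 4] are closed conditions. *)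
Lemma compact_ngon N c : compact [set x : polygons | ngon r N x /\ c <= energy N x].
Proof.
have cP : compact [set x : polygons | forall i, [set: X] (x i)].
  exact: (@tychonoff _ (fun _ : int => X) (fun=> setT)).
apply: (subclosed_compact _ cP) => //.
have -> : [set x : polygons | ngon r N x /\ c <= energy N x] =
    (\bigcap_i [set x : polygons | d (x (i + N%:Z)) (x i) <= 0]) `&`
    (\bigcap_i [set x : polygons | d (x i) (x (i + 1)) <= r / 4]) `&`
    ((fun x : polygons => energy N x) @^-1` [set u | c <= u]).
  apply/seteqP; split=> x /=.
    move=> [[xp xe] xc]; split=> //; split=> i _ /=; last exact: xe.
    by rewrite xp mdistxx.
  move=> [[xp xe] xc]; split=> //; split=> i; last exact: xe.
  by apply/mdist_positivity/eqP; rewrite eq_le mdist_ge0 andbT; exact: xp.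
apply: closedI; last first.
  apply: closed_comp; last exact: closed_ge.
  by move=> x _; exact: continuous_energy.
by apply: closedI; apply: closed_bigI => i _; exact: closed_dist_le.
Qed.

Lemma energy_midpoints_lt N x : (0 < N)%N -> ngon r N x -> energy N x != 0 ->
  energy N (midpoints x) < energy N x.
Proof.
move=> N0 xN Ex; rewrite lt_neqAle (energy_midpoints ug r0 xN) andbT.
apply/eqP => E.
by have [g [/nogeod gc ngc]] := ngon_closed_geodesic ug r0 xN N0 E Ex.
Qed.

(** On the compact set of N-gons of energy at least [e], the drop of energy has a minimum [w],
    positive in the absence of closed geodesics, and the energy has a maximum [m]. After more than
    [m / w] steps no energy can remain above [e]. *)
Lemma midpoints_shorten N e : (0 < N)%N -> 0 < e ->
  exists n, forall x, ngon r N x -> energy N (iter n (@midpoints R X) x) < e.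
Proof.
move=> N0 e0; pose A := [set x : polygons | ngon r N x /\ e <= energy N x].
have [[x0 Ax0]|A0] := pselect (A !=set0); last first.
  exists 0%N => x xN; rewrite ltNge; apply/negP => ex.
  by apply: A0; exists x.
have cA : compact A := @compact_ngon N e.
have cE : {within A, continuous (fun x : polygons => energy N x)}.
  by apply: continuous_subspaceT; exact: continuous_energy.
have cW : {within A, continuous (fun x : polygons => energy N x -
    energy N (midpoints x))}.
  apply/subspace_continuousP => x [xN _]; apply: cvg_within_filter; apply: cvgB.
    exact: continuous_energy.
  apply: (@cvg_energy _ (nbhs (x : polygons)) _ N (fun x => midpoints x)) => i.
  apply: (cvg_geod cX ug) => //; [|exact: cvg_proj|exact: cvg_proj|exact: cvg_cst].
  exact: (ngon_lt r0 _ xN).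
have [x1 /set_mem Ax1 x1min] := compact_EVT_min (ex_intro _ _ Ax0) cA cW.
have [x2 /set_mem Ax2 x2max] := compact_EVT_max (ex_intro _ _ Ax0) cA cE.
set w := _ - _ in x1min; set m := energy N x2 in x2max.
have w0 : 0 < w.
  rewrite subr_gt0; apply: energy_midpoints_lt => //; first exact: Ax1.1.
  by rewrite gt_eqF// (lt_le_trans e0 Ax1.2).
have iterN n x : ngon r N x -> ngon r N (iter n (@midpoints R X) x).
  by move=> xN; elim: n => //= n IH; exact: ngon_midpoints.
have dec n x : ngon r N x -> energy N (iter n (@midpoints R X) x) < e \/
    energy N (iter n (@midpoints R X) x) <= m - w *+ n.
  move=> xN; elim: n => [|n IH] /=.
    have [?|ex] := ltP (energy N x) e; [by left|right].
    by rewrite mulr0n subr0; apply: x2max; rewrite inE.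
  have yN := iterN n x xN; move: (iter n _ x) yN IH => y yN IH.
  have Ey := energy_midpoints ug r0 yN.
  have [ye|ey] := ltP (energy N y) e; first by left; exact: le_lt_trans ye.
  right; case: IH => [|IH]; first by rewrite ltNge ey.
  have := x1min y; rewrite inE => /(_ (conj yN ey)); rewrite mulrSr; lra.
exists (Num.truncn (m / w)).+1 => x xN; case: (dec (Num.truncn (m / w)).+1 x xN) => // En.
apply: (le_lt_trans En); apply: le_lt_trans e0.
rewrite subr_le0 -mulr_natr -ler_pdivrMl// mulrC.
by apply: ltW; rewrite truncnS_gt.
Qed.

End shortening.

(** * Extension of maps from spheres *)

Lemma cvg_pairT (T : Type) (U V : topologicalType) (F : set_system T)
    (FF : Filter F) (f : T -> U) (g : T -> V) (x : U) (y : V) :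
  f @ F --> x -> g @ F --> y -> (f t, g t) @[t --> F] --> (x, y).
Proof. by move=> fx gy; apply: cvg_pair. Qed.

(** * Polar coordinates in the plane *)

Section polar.
Context {R : realType}.
Implicit Types (z : R * R) (t : R).

Definition modulus z : R := Num.sqrt (z.1 ^+ 2 + z.2 ^+ 2).

(* A determination of the argument, continuous off the half-line of
   negative real numbers, where it jumps from pi to - pi. *)
Definition angle z : R :=
  if 0 <= z.2 then acos (z.1 / modulus z) else - acos (z.1 / modulus z).

Lemma modulus_ge0 z : 0 <= modulus z.
Proof. exact: sqrtr_ge0. Qed.

Lemma sqr_modulus z : modulus z ^+ 2 = z.1 ^+ 2 + z.2 ^+ 2.
Proof. by rewrite sqr_sqrtr// addr_ge0// sqr_ge0. Qed.

Lemma modulus_eq0 z : (modulus z == 0) = (z == 0).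
Proof.
apply/eqP/eqP => [z0|->]; last by rewrite /modulus/= expr0n addr0 sqrtr0.
have := sqr_modulus z; rewrite z0 expr0n => /esym/eqP.
rewrite paddr_eq0 ?sqr_ge0// !sqrf_eq0 => /andP[/eqP z1 /eqP z2].
by rewrite [z]surjective_pairing z1 z2.
Qed.

Lemma modulus_cossin c t : 0 <= c -> modulus (c * cos t, c * sin t) = c.
Proof.
by move=> c0; rewrite /modulus/= !exprMn -mulrDr cos2Dsin2 mulr1 sqrtr_sqr ger0_norm.
Qed.

Lemma modulusZ c z : 0 <= c -> modulus (c *: z) = c * modulus z.
Proof.
move=> c0; rewrite /modulus/= -!/(c * _) !exprMn -mulrDr sqrtrM ?sqr_ge0//.
by rewrite sqrtr_sqr ger0_norm.
Qed.

Lemma cos_itv z : -1 <= z.1 / modulus z <= 1.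
Proof.
rewrite -ler_norml normrM normfV (ger0_norm (modulus_ge0 z)).
have [->|z0] := eqVneq (modulus z) 0; first by rewrite invr0 mulr0.
have zp : 0 < modulus z by rewrite lt_neqAle eq_sym z0 modulus_ge0.
rewrite ler_pdivrMr// mul1r -sqrtr_sqr ler_wsqrtr// lerDl sqr_ge0//.
Qed.

Lemma angleP z : [/\ modulus z * cos (angle z) = z.1, modulus z * sin (angle z) = z.2
  & `|angle z| <= pi].
Proof.
have zI := cos_itv z; have zI' : z.1 / modulus z \in `[-1, 1] by rewrite in_itv.
have a0 := acos_ge0 zI; have api := acos_lepi zI.
have -> : cos (angle z) = z.1 / modulus z.
  by rewrite /angle; case: ifP => _; rewrite ?cosN acosK.
have -> : `|angle z| = acos (z.1 / modulus z).
  by rewrite /angle; case: ifP => _; rewrite ?normrN ger0_norm.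
(* At the origin the quotient is [0 / 0 = 0] and the angle is pi / 2; the modulus 0 makes this
   harmless. *)
have [z0|z0] := eqVneq z 0.
  have -> : modulus z = 0 by apply/eqP; rewrite modulus_eq0 z0.
  by rewrite !mul0r {1 2}z0 invr0 mulr0 acos0; split=> //; have := pi_gt0 R; lra.
have zp : 0 < modulus z by rewrite lt_neqAle eq_sym modulus_eq0 z0 modulus_ge0.
split=> //; first by rewrite mulrC divfK// gt_eqF.
have e : modulus z * sin (acos (z.1 / modulus z)) = `|z.2|.
  rewrite sin_acos// -[X in X * _](ger0_norm (modulus_ge0 z)) -sqrtr_sqr -sqrtrM ?sqr_ge0//.
  rewrite -[RHS]sqrtr_sqr; congr Num.sqrt; rewrite expr_div_n mulrBr mulr1.
  by rewrite mulrC divfK ?sqrf_eq0 ?gt_eqF// sqr_modulus addrC addKr.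
rewrite /angle; case: ifP => [z2|/negbT]; first by rewrite e ger0_norm.
by rewrite -ltNge => z2; rewrite sinN mulrN e ltr0_norm// opprK.
Qed.

Lemma cvg_modulus T (F : set_system T) (FF : Filter F) (f : T -> R * R) z :
  f @ F --> z -> modulus (f t) @[t --> F] --> modulus z.
Proof.
move=> fz; have f1 : (f t).1 @[t --> F] --> z.1 by apply: cvg_comp fz _; exact: cvg_fst.
have f2 : (f t).2 @[t --> F] --> z.2 by apply: cvg_comp fz _; exact: cvg_snd.
have zz : (f t).1 ^+ 2 + (f t).2 ^+ 2 @[t --> F] --> z.1 ^+ 2 + z.2 ^+ 2.
  by rewrite !expr2; under eq_fun do rewrite !expr2; apply: cvgD; apply: cvgM.
by rewrite /modulus; apply: cvg_comp zz _; exact: sqrt_continuous.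
Qed.

Lemma cvg_maxr T (F : set_system T) (FF : Filter F) (f : T -> R) (c t : R) :
  f @ F --> t -> Num.max c (f u) @[u --> F] --> Num.max c t.
Proof.
move=> ft; apply: cvg_comp ft _.
by apply: (@continuous_max _ _ (fun=> c) id); [exact: cvg_cst|exact: cvg_id].
Qed.

(** The ends -1 and 1 are included, being reached on the real axis; continuity there comes from
    inverting [cos] on the closed interval from 0 to pi. *)
Lemma cvg_acos T (F : set_system T) (FF : Filter F) (f : T -> R) t :
  -1 <= t <= 1 -> (forall u, -1 <= f u <= 1) -> f @ F --> t ->
  acos (f u) @[u --> F] --> acos t.
Proof.
move=> tI fI ft; have := @segment_can_ge_continuous R 0 pi cos (@acos R) (pi_ge0 R)
  (continuous_subspaceT (@continuous_cos R)) (@cosK R).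
rewrite cospi cos0 => /subspace_continuousP/(_ t).
rewrite /= in_itv/= => /(_ tI) ca; apply: cvg_comp ca.
move=> A /ft; apply: (@filterS _ F _) => u; apply.
by rewrite /= in_itv/= fI.
Qed.

Lemma cvg_cos_angle T (F : set_system T) (FF : Filter F) (f : T -> R * R) z :
  z != 0 -> f @ F --> z ->
  acos ((f t).1 / modulus (f t)) @[t --> F] --> acos (z.1 / modulus z).
Proof.
move=> z0 fz; apply: cvg_acos => //; [exact: cos_itv|by move=> u; exact: cos_itv|].
apply: cvgM; first by apply: cvg_comp fz _; exact: cvg_fst.
by apply: cvgV; [rewrite modulus_eq0|exact: cvg_modulus].
Qed.

End polar.

Section sphere.
Context {R : realType} (X : metricType R) (r : R) (m : nat).
Local Notation d := (@mdist R X).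
Local Notation V := ('rV[R]_m * (R * R))%type.
Implicit Types (u v : V) (q : 'rV[R]_m) (F G : V -> X) (s t a : R) (N n : nat) (i j : int).
Hypothesis cX : compact [set: X].
Hypothesis ug : uniquely_geodesic X r.
Hypothesis r0 : 0 < r.

(** A gauge homogeneous of degree 1, vanishing only at 0. On the sphere [rho v = 1] the circle over
    [q] has radius [1 - |q|], which collapses linearly at the boundary of the ball. *)
Definition rho v : R := `|v.1| + modulus v.2.

Lemma rho_ge0 v : 0 <= rho v.
Proof. by rewrite addr_ge0// modulus_ge0. Qed.

Lemma rhoZ c v : 0 <= c -> rho (c *: v) = c * rho v.
Proof. by move=> c0; rewrite /rho/= normrZ modulusZ// mulrDr (ger0_norm c0). Qed.

Lemma cvg_rho T (FT : set_system T) (FF : Filter FT) (f : T -> V) v :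
  f @ FT --> v -> rho (f t) @[t --> FT] --> rho v.
Proof.
move=> fv; apply: cvgD.
  by apply: cvg_norm; apply: cvg_comp fv _; exact: cvg_fst.
by apply: cvg_modulus; apply: cvg_comp fv _; exact: cvg_snd.
Qed.

Lemma continuous_rho : continuous rho.
Proof. by move=> v; apply: (@cvg_rho _ (nbhs v) _ id). Qed.

Lemma near_rho_lt v a : rho v < a -> \forall u \near v, rho u < a.
Proof. by move=> va; exact: cvgr_lt (@continuous_rho v) _ va. Qed.

Lemma near_rho_gt v a : a < rho v -> \forall u \near v, a < rho u.
Proof. by move=> va; exact: cvgr_gt (@continuous_rho v) _ va. Qed.

Definition continuous_off0 F := forall v, 0 < rho v -> F u @[u --> v] --> F v.

(** A map of the sphere is represented by its radial extension to V, the value at 0 being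
    irrelevant. Extending it to the ball then means changing it near the origin only; the free
    radius [a] leaves room for collars. *)
Definition extendable F := exists E : V -> X, continuous E /\
  exists2 a, 0 < a & forall v, a <= rho v -> E v = F v.

(* The extension of G is continued along the geodesics from G v to F v. *)
Lemma extendable_close F G : continuous_off0 F -> continuous_off0 G ->
  (forall v, 0 < rho v -> d (G v) (F v) < r) -> extendable G -> extendable F.
Proof.
move=> cF cG GF [E [cE [a a0 EG]]].
(* The parameter runs from 0 at [rho v = a] to 1 at [rho v = 2 * a], and is clamped beyond. *)
pose g v := geod (G v) (F v) (rho v / a - 1).
pose E' v := if rho v <= a then E v else g v.
have ra (v : V) : a <= rho v -> 0 < rho v by exact: lt_le_trans.
have cg v : 0 < rho v -> g u @[u --> v] --> g v.
  move=> v0; apply: (cvg_geod cX ug); [exact: GF|exact: cG|exact: cF|].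
  apply: cvgB; last exact: cvg_cst.
  by apply: cvgM; [exact: continuous_rho|exact: cvg_cst].
exists E'; split; last first.
  exists (2 * a) => [|v av]; first by rewrite mulr_gt0.
  rewrite /E' leNgt (lt_le_trans _ av)/=; last by lra.
  rewrite /g (geod_ge1 ug)//; first by apply: GF; apply: ra; lra.
  by rewrite lerBrDr ler_pdivlMr//; lra.
move=> v; rewrite /continuous_at; have [va|av|va] := ltgtP (rho v) a.
- have -> : E' v = E v by rewrite /E' (ltW va).
  apply: cvg_trans (cE v); apply: near_eq_cvg; near=> u.
  have ua : rho u < a by near: u; exact: (near_rho_lt va).
  by rewrite /E' (ltW ua).
- have -> : E' v = g v by rewrite /E' leNgt av.
  apply: cvg_trans (cg v (lt_trans a0 av)); apply: near_eq_cvg; near=> u.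
  have ua : a < rho u by near: u; exact: (near_rho_gt av).
  by rewrite /E' leNgt ua.
- have v0 : 0 < rho v by rewrite va.
  have E'v : E' v = E v by rewrite /E' va lexx.
  apply: (@cvg_alternative R X _ _ _ E' E g); rewrite ?E'v; [exact: cE| |].
    have -> : E v = g v.
      by rewrite EG ?va// /g va divff ?gt_eqF// subrr (geod_le0 ug)// GF.
    exact: cg.
  by apply: nearW => u; rewrite /E'; case: ifP; [left|right].
Unshelve. all: by end_near. Qed.

Definition direction v : 'rV[R]_m := (rho v)^-1 *: v.1.

Lemma cvg_direction v : 0 < rho v -> direction u @[u --> v] --> direction v.
Proof.
move=> v0; apply: cvgZ; last exact: cvg_fst.
by apply: cvgV; [rewrite gt_eqF|exact: continuous_rho].
Qed.

Lemma norm_direction v : 0 < rho v -> `|direction v| = `|v.1| / rho v.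
Proof. by move=> v0; rewrite normrZ normfV mulrC ger0_norm ?(ltW v0). Qed.

Lemma direction_modulus v : 0 < rho v -> 1 - `|direction v| = modulus v.2 / rho v.
Proof.
move=> v0; rewrite norm_direction// -[X in X - _](divff (x := rho v)) ?gt_eqF//.
by rewrite -mulrBl /rho addrC addKr.
Qed.

(* A family of closed polygons parametrized by the unit ball, constant on its
   boundary, is seen as a map from the sphere: the fibres of direction are circles
   which collapse on the boundary. *)
Definition polygon_family N (y : 'rV[R]_m -> int -> X) :=
  [/\ forall q, ngon r N (y q), forall i, continuous (y ^~ i)
    & forall q i, 1 <= `|q| -> y q i = y q 0].

Definition sphere_map N (y : 'rV[R]_m -> int -> X) v : X :=
  polyline (y (direction v)) (N%:R / (2 * pi) * angle v.2).

Lemma polygon_family_midpoints N y : polygon_family N y ->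
  polygon_family N (fun q => midpoints (y q)).
Proof.
move=> [yN yc y1]; split=> [q|i q|q i q1]; first exact: ngon_midpoints.
  apply: (@cvg_geod _ _ _ cX ug _ (nbhs q) _ (y ^~ i) (y ^~ (i + 1)) (fun=> 2^-1)).
  - exact: (ngon_lt r0 _ (yN q)).
  - exact: yc.
  - exact: yc.
  - exact: cvg_cst.
by rewrite /midpoints !(y1 q (_ + _))// !(y1 q i)// !(geodxx ug).
Qed.

Lemma polyline_periodic_int N x s c : (0 < N)%N -> ngon (X := X) r N x -> exists2 k : nat,
  (k < N)%N & d (polyline x s) c <= d (x k%:Z) (x (k%:Z + 1)) + d (x k%:Z) c.
Proof.
move=> N0 xN; have [k kN xE] := periodic_int N0 xN.1 (Num.floor s).
exists k => //; apply: (le_trans (metric_triangle _ (x k%:Z) _)); rewrite lerD2r.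
have := xE 0; rewrite !addr0 => <-; rewrite -(xE 1) metric_sym.
by apply: (polyline_vertex ug) => j; exact: (ngon_lt r0 _ xN).
Qed.

(** Two places are delicate. Where [angle] jumps by 2 pi, the two parameters differ by the period
    [N]. Where [v.2 = 0] the angle has no limit, but the polygon is constant and nearby polygons
    have all their vertices close to that constant. *)
Lemma continuous_sphere_map N y : (0 < N)%N -> polygon_family N y ->
  continuous_off0 (sphere_map N y).
Proof.
move=> N0 [yN yc y1] v v0; have pi0 := pi_gt0 R.
have yd i : y (direction u) i @[u --> v] --> y (direction v) i.
  by apply: (@cvg_comp _ _ _ direction (y ^~ i) _ (nbhs (direction v)));
    [exact: cvg_direction|exact: yc].
have yr q j : d (y q j) (y q (j + 1)) < r by exact: (ngon_lt r0 _ (yN q)).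
have [z0|z0] := eqVneq v.2 0; last first.
  have ca : acos (u.2.1 / modulus u.2) @[u --> v] --> acos (v.2.1 / modulus v.2).
    by apply: (@cvg_cos_angle _ _ (nbhs v) _ (fun u => u.2)) => //; exact: cvg_snd.
  pose c : R := N%:R / (2 * pi); pose g e u := polyline (y (direction u))
    (c * (e * acos (u.2.1 / modulus u.2))).
  have cg e : g e u @[u --> v] --> g e v.
    apply: (@cvg_polyline _ _ _ cX ug _ (nbhs v) _ (fun u => y (direction u))) => //.
    by apply: cvgM; [exact: cvg_cst|apply: cvgM; [exact: cvg_cst|]].
  have sg u : sphere_map N y u = if 0 <= u.2.2 then g 1 u else g (-1) u.
    by rewrite /sphere_map /angle /g; case: ifP => _; rewrite ?mul1r ?mulN1r.
  have c2 : u.2.2 @[u --> v] --> v.2.2.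
    by apply: (@cvg_comp _ _ _ (fun u : V => u.2)); [exact: cvg_snd|exact: cvg_snd].
  have [b0|b0|b0] := ltgtP v.2.2 0.
  - rewrite sg leNgt b0/=; apply: cvg_trans (cg (-1)); apply: near_eq_cvg; near=> u.
    have u0 : u.2.2 < 0 by near: u; exact: cvgr_lt c2 _ b0.
    by rewrite sg leNgt u0.
  - rewrite sg (ltW b0)/=; apply: cvg_trans (cg 1); apply: near_eq_cvg; near=> u.
    have u0 : 0 < u.2.2 by near: u; exact: cvgr_gt c2 _ b0.
    by rewrite sg (ltW u0).
  - have g1 : g (-1) v = g 1 v.
      have rv : modulus v.2 = `|v.2.1| by rewrite /modulus b0 expr0n addr0 sqrtr_sqr.
      have v21 : v.2.1 != 0.
        by apply: contra z0 => /eqP e; rewrite [v.2]surjective_pairing e b0.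
      rewrite /g rv; have [vp|vn] := ltP 0 v.2.1.
        by rewrite gtr0_norm// divff// acos1 !mulr0.
      rewrite ler0_norm// invrN mulrN divff// acosN1 mulN1r mul1r.
      rewrite -(polyline_periodic _ (yN (direction v)).1); congr polyline.
      have : c * (2 * pi) = N%:R by rewrite /c divfK// gt_eqF// mulr_gt0.
      lra.
    apply: (@cvg_alternative R X _ _ _ (sphere_map N y) (g 1) (g (-1))).
    + by rewrite sg b0 lexx; exact: cg.
    + by rewrite sg b0 lexx -g1; exact: cg.
    + by apply: nearW => u; rewrite sg; case: ifP; [left|right].
have n1 : 1 <= `|direction v|.
  have := direction_modulus v0; have /eqP -> : modulus v.2 == 0 by rewrite modulus_eq0 z0.
  by rewrite mul0r; lra.
have sv : sphere_map N y v = y (direction v) 0.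
  have [k _] := polyline_periodic_int (N%:R / (2 * pi) * angle v.2) (y (direction v) 0) N0
    (yN (direction v)).
  rewrite !(y1 _ (_ + _))// !(y1 _ k%:Z)// mdistxx addr0 => le0.
  by apply/mdist_positivity/eqP; rewrite eq_le le0 mdist_ge0.
apply/metricType_numDomainType.cvgrPdist_lt => e e0; near=> u.
(* [N + 1] indices, since the last edge ends at index [N]. Three distances below [e / 4] are added
   in the end: two for an edge, one for its first vertex. *)
have near_vertex : forall k : 'I_N.+1, d (y (direction v) 0) (y (direction u) (k : nat)%:Z) < e / 4.
  near: u; apply: filter_forall => k; rewrite -(y1 _ (k : nat)%:Z n1).
  by apply: (metricType_numDomainType.cvgr_dist_lt (yd _)); lra.
rewrite sv metric_sym.
have [k kN le1] := polyline_periodic_int (N%:R / (2 * pi) * angle u.2) (y (direction v) 0) N0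
  (yN (direction u)).
apply: (le_lt_trans le1); have kN1 : (k < N.+1)%N by exact: ltnW.
have := near_vertex (Ordinal kN1); have := near_vertex (Ordinal (kN : (k.+1 < N.+1)%N)).
rewrite /= intS (addrC 1).
have := metric_triangle (y (direction u) k%:Z) (y (direction v) 0)
  (y (direction u) (k%:Z + 1)).
rewrite (metric_sym (y (direction u) k%:Z) (y (direction v) 0)); lra.
Unshelve. all: by end_near. Qed.

(** The way through [midpoints x i] and [x (i + 1)] has length at most r / 4 + r / 8 + r / 4. *)
Lemma sphere_map_midpoints N y v : polygon_family N y ->
  d (sphere_map N (fun q => midpoints (y q)) v) (sphere_map N y v) < r.
Proof.
move=> [yN _ _]; rewrite /sphere_map; move: (_ * angle _) => s.
have xN := yN (direction v); move: (y _) xN => x xN.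
have xr j := ngon_lt r0 j xN; have mN := ngon_midpoints ug r0 xN.
have mr j := ngon_lt r0 j mN; set i := Num.floor s.
have e1 := polyline_vertex1 ug s xr; have e2 := polyline_vertex ug s mr.
have e3 := midpoints_distr ug (xr i).
have := metric_triangle (polyline (midpoints x) s) (midpoints x i) (polyline x s).
have := metric_triangle (midpoints x i) (x (i + 1)) (polyline x s).
rewrite -/i in e1 e2; have := xN.2 i; have := mN.2 i; rewrite e3.
rewrite (metric_sym _ (midpoints x i)) (metric_sym (x (i + 1)) (polyline x s)).
have := r0; lra.
Qed.

(** Each edge is at most [e], so the whole polygon lies within [N * e < r] of its vertex 0. The map
    [y (direction v) 0] sees only the ball and therefore extends over the origin. *)
Lemma extendable_short N y : (0 < N)%N -> polygon_family N y ->
  (forall q, energy N (y q) < (r / N.+2%:R) ^+ 2) -> extendable (sphere_map N y).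
Proof.
move=> N0 yF Ey; have [yN yc _] := yF; set e := r / N.+2%:R in Ey.
have e0 : 0 < e by rewrite divr_gt0.
have re : r = e *+ N.+2 by rewrite -mulr_natr divfK// pnatr_eq0.
have edge q (k : nat) : (k < N)%N -> d (y q k%:Z) (y q (k%:Z + 1)) <= e.
  move=> kN; rewrite -(@ler_pXn2r _ 2)// ?nnegrE ?mdist_ge0 ?(ltW e0)//.
  apply: le_trans (ltW (Ey q)); rewrite /energy big_mkord.
  by rewrite (bigD1 (Ordinal kN))//= lerDl sumr_ge0// => i _; exact: sqr_ge0.
have vertex q (k : nat) : (k <= N)%N -> d (y q k%:Z) (y q 0) <= e *+ k.
  elim: k => [|k IH] kN; first by rewrite mdistxx mulr0n.
  have := IH (ltnW kN); have := edge q k kN.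
  have := metric_triangle (y q k.+1%:Z) (y q k%:Z) (y q 0).
  by rewrite intS (addrC 1) (metric_sym (y q (k%:Z + 1)) (y q k%:Z)) mulrS; lra.
apply: (@extendable_close _ (fun v => y (direction v) 0)).
- exact: continuous_sphere_map.
- move=> v v0; apply: (@cvg_comp _ _ _ direction (y ^~ 0) _ (nbhs (direction v))).
    exact: cvg_direction.
  exact: yc.
- move=> v v0; rewrite metric_sym /sphere_map.
  have [k kN le1] := polyline_periodic_int (N%:R / (2 * pi) * angle v.2) (y (direction v) 0) N0
    (yN (direction v)).
  apply: (le_lt_trans le1); apply: (le_lt_trans (lerD (edge _ _ kN) (vertex _ _ (ltnW kN)))).
  rewrite -mulrS [ltRHS]re -(mulr_natr e N.+2) -(mulr_natr e k.+1).
  by rewrite ltr_pM2l// ltr_nat !ltnS; exact: ltnW.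
(* The argument of [y] is [v.1] where [rho v <= 1] and [direction v] elsewhere. *)
exists (fun v => y ((Num.max 1 (rho v))^-1 *: v.1) 0); split.
  move=> v; apply: (@cvg_comp _ _ _ (fun v : V => (Num.max 1 (rho v))^-1 *: v.1)
    (y ^~ 0)); last exact: yc.
  apply: cvgZ; last exact: cvg_fst.
  apply: cvgV; first by rewrite gt_eqF// lt_max ltr01.
  by apply: cvg_maxr; exact: continuous_rho.
by exists 1 => // v v1; rewrite (max_idPr v1).
Unshelve. all: by end_near. Qed.

(** Over [q] the polygon samples [F] at [N] equidistant points of the circle over [q]; [N] comes
    from continuity in the angle, uniform by compactness. *)
Lemma sphere_polygons F : continuous_off0 F ->
  (forall c v, 0 < c -> 0 < rho v -> F (c *: v) = F v) ->
  exists N y, [/\ (0 < N)%N, polygon_family N y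
    & forall v, 0 < rho v -> d (sphere_map N y v) (F v) < r].
Proof.
move=> cF FZ; have pi0 := pi_gt0 R.
(* Over [|q| >= 1] the circle is reduced to the point [(q, 0)], so the polygons are defined and
   constant there. *)
pose w q : R := Num.max 0 (1 - `|q|).
pose pt q t : V := (q, (w q * cos t, w q * sin t)).
have w0 q : 0 <= w q by rewrite le_max lexx.
have rho_pt q t : 0 < rho (pt q t).
  by rewrite /rho/= modulus_cossin// /w /Num.max; case: ifP; have := normr_ge0 q; lra.
have cw T (FT : set_system T) (FF : Filter FT) (f : T -> 'rV[R]_m) q :
    f @ FT --> q -> w (f t) @[t --> FT] --> w q.
  by move=> fq; apply: cvg_maxr; apply: cvgB; [exact: cvg_cst|exact: cvg_norm].
have cpt T (FT : set_system T) (FF : Filter FT) (f : T -> 'rV[R]_m) (g : T -> R) q t :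
    f @ FT --> q -> g @ FT --> t -> pt (f u) (g u) @[u --> FT] --> pt q t.
  move=> fq gt; apply: cvg_pairT => //; apply: cvg_pairT; apply: cvgM; do ?exact: cw.
    by apply: cvg_comp gt _; exact: continuous_cos.
  by apply: cvg_comp gt _; exact: continuous_sin.
pose G (x : 'rV[R]_m * R) := F (pt x.1 x.2).
have cG T (FT : set_system T) (FF : Filter FT) (f : T -> 'rV[R]_m) (g : T -> R) q t :
    f @ FT --> q -> g @ FT --> t -> G (f u, g u) @[u --> FT] --> G (q, t).
  by move=> fq gt; apply: cvg_comp (cpt _ _ _ _ _ _ _ fq gt) _; apply: cF; exact: rho_pt.
(* The interval contains the values of [angle], in [[- pi, pi]], as well as the sample angles of one
   period, in [[0, 2 * pi]]. *)
pose A := [set q : 'rV[R]_m | `|q| <= 1] `*` `[- pi, (2 * pi : R)]%classic.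
have cA : compact A.
  apply: compact_setX; last exact: segment_compact.
  apply: bounded_closed_compact.
    by exists 1; split => // M M1 q /= q1; exact: le_trans q1 (ltW M1).
  apply: (@closed_comp _ _ (fun q : 'rV[R]_m => `|q|) [set x | x <= 1]).
    by move=> q _; exact: (@norm_continuous _ 'rV[R]_m).
  exact: closed_le.
pose P (e : R) (x : 'rV[R]_m * R) := forall t, `|x.2 - t| < e -> d (G x) (G (x.1, t)) < r / 8.
have : \forall e \near (0 : R)^'+, A `<=` P e.
  move/compact_near_coveringP: cA; apply => x _.
  have r16 : 0 < r / 16 by have := r0; lra.
  have Gx : G (u.1, u.2) @[u --> x] --> G (x.1, x.2).
    by apply: cG; [exact: cvg_fst|exact: cvg_snd].
  have := metricType_numDomainType.cvgr_dist_lt Gx r16.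
  move=> [[B1 B2] [/= nB1 nB2] B12].
  have [e /= e0 eB] := nB2.
  exists (B1 `*` ball x.2 (e / 2), [set e' | e' <= e / 2]).
    split; first by exists (B1, ball x.2 (e / 2)) => //=; split => //; apply: nbhsx_ballx; lra.
    by apply: nbhs_right_le; lra.
  move=> [u e'] /= [[u1 u2] ee'] t ut.
  have xu : `|x.2 - u.2| < e / 2 by [].
  have := ler_distD u.2 x.2 t => tri.
  have xt : B2 t by apply: eB => /=; lra.
  have xu2 : B2 u.2 by apply: eB => /=; lra.
  have := B12 u (conj u1 xu2); have := B12 (u.1, t) (conj u1 xt).
  have := metric_triangle (G u) (G x) (G (u.1, t)).
  by rewrite (metric_sym (G u) (G x)) /=; lra.
move=> eP; near (0 : R)^'+ => e.
have e0 : 0 < e by near: e; exact: nbhs_right_gt.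
have AP : A `<=` P e by near: e.
pose N := (Num.truncn (2 * pi / e)).+1.
have Ne : 2 * pi / N%:R < e.
  by rewrite ltr_pdivrMr ?ltr0n// (mulrC e) -ltr_pdivrMr//; exact: truncnS_gt.
pose th i : R := 2 * pi / N%:R * i%:~R.
pose y q i := G (q, th i).
have N0 : N%:R != 0 :> R by rewrite pnatr_eq0.
have thN i : th (i + N%:Z) = th i + pi *+ 2.
  by rewrite /th intrD mulrDr divfK// mulr_natl.
have th1 i : `|th i - th (i + 1)| < e.
  have -> : th i - th (i + 1) = - (2 * pi / N%:R) by rewrite /th intrS1; ring.
  rewrite normrN ger0_norm//.
  by rewrite divr_ge0 ?ler0n//; lra.
have yp q i : y q (i + N%:Z) = y q i.
  by rewrite /y /G /pt/= thN cosD2pi sinD2pi.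
have y_const q i : 1 <= `|q| -> y q i = y q 0.
  move=> q1; rewrite /y /G /pt/=; have -> : w q = 0 by rewrite /w max_l//; lra.
  by rewrite !mul0r.
have yN q : ngon r N (y q).
  split=> // i; have [q1|q1] := leP `|q| 1; last first.
    by rewrite (y_const q i) ?ltW// (y_const q (i + 1)) ?ltW// mdistxx; have := r0; lra.
  have [k kN yE] := periodic_int (isT : (0 < N)%N) (yp q) i.
  have := yE 0; rewrite !addr0 => ->; rewrite yE.
  have : A (q, th k%:Z).
    split => //; rewrite /= in_itv/=; have k0 : (0 : R) <= k%:R by rewrite ler0n.
    have kN' : k%:R <= N%:R :> R by rewrite ler_nat ltnW.
    rewrite /th -[k%:~R]/(k%:R : R); apply/andP; split.
      by apply: (@le_trans _ _ 0); [lra|rewrite !mulr_ge0// ?invr_ge0 ?ler0n//; lra].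
    by rewrite mulrAC ler_pdivrMr ?ltr0n// ler_pM2l//; lra.
  by move=> /AP/(_ _ (th1 k%:Z)); have := r0; rewrite /y; lra.
exists N, y; split=> //.
  by split=> // i q; apply: (@cG _ (nbhs q) _ id (fun=> th i)); [exact: cvg_id|exact: cvg_cst].
move=> v v0; set q := direction v.
have [ca sa api] := angleP v.2.
have q1 : `|q| <= 1.
  have := direction_modulus v0; have : 0 <= modulus v.2 / rho v.
    by rewrite divr_ge0 ?modulus_ge0 ?ltW.
  by rewrite -/q; lra.
have -> : F v = G (q, angle v.2).
  rewrite -(FZ (rho v)^-1)// ?invr_gt0//; congr F.
  rewrite /pt /w direction_modulus// max_r ?divr_ge0 ?modulus_ge0 ?ltW//=.
  rewrite !(mulrAC _ (rho v)^-1) ca sa [LHS]surjective_pairing; congr pair.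
  by rewrite [LHS]surjective_pairing; congr pair; rewrite /= mulrC.
set s := N%:R / (2 * pi) * angle v.2; set i := Num.floor s.
have /andP[is1 si1] := floor_itv s; rewrite -/i intrS1 in is1 si1.
have as_ : angle v.2 = 2 * pi / N%:R * s.
  have pi20 : 2 * pi != 0 :> R by rewrite gt_eqF// mulr_gt0.
  by rewrite /s mulrA mulrA divfK// divff// mul1r.
have c0 : 0 < (2 * pi / N%:R : R) by rewrite divr_gt0 ?ltr0n// mulr_gt0.
have ath : `|angle v.2 - th i| < e.
  apply: le_lt_trans Ne; rewrite as_ /th -mulrBr normrM gtr0_norm// -[leRHS]mulr1.
  by rewrite ler_pM2l// ger0_norm; lra.
have Aq : A (q, angle v.2).
  by split=> //; rewrite /= in_itv/=; move: api; rewrite ler_norml; lra.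
have := AP _ Aq _ ath; rewrite /= -/(y q i) => e1.
have e2 := polyline_vertex ug s (fun j => ngon_lt r0 j (yN q)).
have e3 := (yN q).2 i; rewrite -/i in e2.
have := metric_triangle (polyline (y q) s) (y q i) (G (q, angle v.2)).
rewrite (metric_sym (polyline _ _) (y q i)) (metric_sym (y q i) (G _)) /sphere_map -/q -/s.
by have := r0; lra.
Unshelve. all: by end_near. Qed.

Lemma sphere_extendable F :
  (forall g : R -> X, closed_geodesic g -> constant_curve g) ->
  continuous_off0 F -> (forall c v, 0 < c -> 0 < rho v -> F (c *: v) = F v) ->
  extendable F.
Proof.
move=> nogeod cF FZ; have [N [y [N0 yF yFr]]] := sphere_polygons cF FZ.
have e0 : 0 < (r / N.+2%:R) ^+ 2 by rewrite exprn_gt0// divr_gt0.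
have [n short] := midpoints_shorten cX ug r0 nogeod N0 e0.
have {}short q : energy N (iter n (@midpoints R X) (y q)) < (r / N.+2%:R) ^+ 2.
  by apply: short; case: yF.
apply: (extendable_close cF (continuous_sphere_map N0 yF) yFr).
(* The homotopies are run backwards: the polygons after [n] steps are short, and extendability
   returns from them one step at a time. *)
elim: n y yF {yFr} short => [|n IH] y yF short; first exact: extendable_short.
apply: (extendable_close (G := sphere_map N (fun q => midpoints (y q)))).
- exact: continuous_sphere_map.
- exact/continuous_sphere_map/polygon_family_midpoints.
- by move=> v _; exact: sphere_map_midpoints.
apply: IH => [|q]; first exact: polygon_family_midpoints.
by rewrite -iterSr.
Qed.

End sphere.

(** * Filling boundaries of simplices *)

Section simplex_retraction.
Context {R : realType} (k : nat).
Implicit Types (u : 'rV[R]_k.+1) (t : simplex R k).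

Lemma cvg_rV n T (F : set_system T) (FF : Filter F) (f : T -> 'rV[R]_n) (l : 'rV[R]_n) :
  (forall j, f t ord0 j @[t --> F] --> l ord0 j) -> f @ F --> l.
Proof.
move=> fl; apply/cvg_ballP => e e0; near=> t.
have : forall j, ball (l ord0 j) e (f t ord0 j).
  by near: t; apply: filter_forall => j; move/cvg_ballP: (fl j); exact.
by move=> h; split=> // i j; rewrite ord1.
Unshelve. all: by end_near. Qed.

Lemma cvg_coord n T (F : set_system T) (FF : Filter F) (f : T -> 'rV[R]_n)
    (l : 'rV[R]_n) j : f @ F --> l -> f t ord0 j @[t --> F] --> l ord0 j.
Proof.
move=> fl; apply: (@cvg_comp _ _ _ f (fun v : 'rV[R]_n => v ord0 j) _ (nbhs l)) => //.
exact: coord_continuous.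
Qed.

Lemma coord_norm n (v : 'rV[R]_n) j : `|v ord0 j| <= `|v|.
Proof.
rewrite [leRHS]mx_normrE.
exact: (le_bigmax _ (fun ij : 'I_1 * 'I_n => `|v ij.1 ij.2|) (ord0, j)).
Qed.

Lemma cvg_sumr (I : finType) T (F : set_system T) (FF : Filter F) (f : T -> I -> R)
    (l : I -> R) :
  (forall j, f t j @[t --> F] --> l j) -> \sum_j f t j @[t --> F] --> \sum_j l j.
Proof.
move=> fl; elim: (index_enum I) => [|j s IH].
  by under eq_fun do rewrite big_nil; rewrite big_nil; exact: cvg_cst.
by under eq_fun do rewrite big_cons; rewrite big_cons; exact: cvgD.
Qed.

Definition positive_mass u : R := \sum_j Num.max 0 (u ord0 j).

(* Negative coordinates are cut off; a total mass less than 1 is completed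
   uniformly, a total mass greater than 1 is normalized. *)
Definition simplex_row u : 'rV[R]_k.+1 :=
  \row_j ((Num.max 0 (u ord0 j) + Num.max 0 (1 - positive_mass u) / k.+1%:R) /
          Num.max 1 (positive_mass u)).

Lemma simplex_rowP u : std_simplex (simplex_row u).
Proof.
have k0 : k.+1%:R != 0 :> R by rewrite pnatr_eq0.
have m0 : 0 < Num.max 1 (positive_mass u) by rewrite lt_max ltr01.
split=> [j|].
  by rewrite mxE divr_ge0 ?(ltW m0)// addr_ge0// ?divr_ge0// ?ler0n// le_max lexx.
under eq_bigr do rewrite mxE; rewrite -mulr_suml big_split/=.
rewrite sumr_const card_ord -[X in _ + X]mulr_natr divfK// -/(positive_mass u).
have [m1|m1] := leP 1 (positive_mass u).
  by rewrite (max_l _)// ?addr0 ?divff ?gt_eqF// ?subr_le0//; lra.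
by rewrite (max_r _)// ?subrKC ?divr1//; lra.
Qed.

Definition simplex_retract u : simplex R k := SigSub (mem_set (simplex_rowP u)).

Lemma simplex_retractK t : simplex_retract (\val t) = t.
Proof.
have [t0 t1] := set_valP t.
have mt : positive_mass (\val t) = 1.
  by rewrite -[RHS]t1; apply: eq_bigr => j _; rewrite max_r// t0.
apply: val_inj; apply/rowP => j; rewrite /= mxE mt subrr maxxx mul0r addr0.
by rewrite maxxx divr1 max_r// t0.
Qed.

Lemma cvg_simplex_row T (F : set_system T) (FF : Filter F) (f : T -> 'rV[R]_k.+1) u :
  f @ F --> u -> simplex_row (f t) @[t --> F] --> simplex_row u.
Proof.
move=> fu; apply: cvg_rV => j; rewrite mxE; under eq_fun do rewrite mxE.
have cm i : Num.max 0 (f t ord0 i) @[t --> F] --> Num.max 0 (u ord0 i).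
  by apply: cvg_maxr; exact: cvg_coord.
have cM : positive_mass (f t) @[t --> F] --> positive_mass u by exact: cvg_sumr.
apply: cvgM; last first.
  by apply: cvgV; [rewrite gt_eqF// lt_max ltr01|exact: cvg_maxr].
apply: cvgD => //; apply: cvgM; last exact: cvg_cst.
by apply: cvg_maxr; apply: cvgB => //; exact: cvg_cst.
Qed.

Lemma cvg_simplex_retract T (F : set_system T) (FF : Filter F) (f : T -> 'rV[R]_k.+1) u :
  f @ F --> u -> simplex_retract (f t) @[t --> F] --> simplex_retract u.
Proof.
have cr : continuous simplex_retract.
  suff cs : continuous simplex_row by apply: continuous_comp_initial.
  by move=> {}u; apply: (@cvg_simplex_row _ (nbhs u) _ id).
by move=> fu; apply: cvg_comp fu _; exact: cr.
Qed.

End simplex_retraction.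

Section filling.
Context {R : realType} (X : metricType R) (m : nat).
Local Notation V := ('rV[R]_m * (R * R))%type.
Implicit Types (v : V) (i j : 'I_m.+3).

Hypothesis ext : forall F : V -> X, continuous_off0 F ->
  (forall c v, 0 < c -> 0 < rho v -> F (c *: v) = F v) -> extendable F.

(* V is identified with the quotient of R^(m+3) by the diagonal, the last
   coordinate being normalized to 0. *)
Definition hcoord v i : R :=
  if insub (i : nat) : option 'I_m is Some j then v.1 ord0 j
  else if i == m :> nat then v.2.1 else if i == m.+1 :> nat then v.2.2 else 0.

Definition hpoint (t : 'rV[R]_m.+3) : V :=
  let x (k : nat) := t ord0 (inord k) - t ord0 ord_max in
  (\row_j x j, (x m, x m.+1)).

Lemma hcoord_hpoint t i : hcoord (hpoint t) i = t ord0 i - t ord0 ord_max.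
Proof.
rewrite /hcoord; case: insubP => [j _ ji|im]; first by rewrite mxE ji inord_val.
case: eqP => [e|i0]; first by rewrite /= -[i in RHS]inord_val e.
case: eqP => [e|i1]; first by rewrite /= -[i in RHS]inord_val e.
suff -> : i = ord_max by rewrite subrr.
apply: val_inj => /=; have := ltn_ord i; rewrite -leqNgt in im.
rewrite ltnS leq_eqVlt => /predU1P[//|]; rewrite ltnS leq_eqVlt => /predU1P[//|].
by rewrite ltnS leq_eqVlt => /predU1P[//|]; rewrite ltnNge im.
Qed.

Lemma hcoordZ c v i : hcoord (c *: v) i = c * hcoord v i.
Proof.
rewrite /hcoord; case: insubP => [j _ _|_] /=; first by rewrite mxE.
by case: ifP => // _; case: ifP => // _; rewrite mulr0.
Qed.

Lemma hcoord_max v : hcoord v ord_max = 0.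
Proof.
rewrite /hcoord; case: insubP => [j /= |_ /=]; first by rewrite ltnNge -addn2 leq_addr.
by rewrite !gtn_eqF.
Qed.

Lemma coord_modulus (z : R * R) :
  [/\ `|z.1| <= modulus z & `|z.2| <= modulus z].
Proof.
by split; rewrite /modulus -sqrtr_sqr ler_wsqrtr// ?lerDl ?lerDr sqr_ge0.
Qed.

Lemma hcoord_rho v i : `|hcoord v i| <= rho v.
Proof.
have [r1 r2] := coord_modulus v.2; have n0 := normr_ge0 v.1; have r0 := modulus_ge0 v.2.
rewrite /hcoord /rho; case: insubP => [j _ _|_] /=.
  by have := coord_norm v.1 j; lra.
by case: ifP => _; [lra|case: ifP => _; [lra|rewrite normr0; lra]].
Qed.

Lemma hcoord_eq0 v : (forall i, hcoord v i = 0) -> rho v = 0.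
Proof.
move=> v0; have a0 : v.1 = 0.
  apply/rowP => j; rewrite mxE.
  have jm : (j < m.+3)%N by rewrite (leq_trans (ltn_ord j))// -addn3 leq_addr.
  by have := v0 (Ordinal jm); rewrite /hcoord /= valK.
have b1 : v.2.1 = 0.
  have mm : (m < m.+3)%N by rewrite ltnS -addn2 leq_addr.
  have := v0 (Ordinal mm); rewrite /hcoord; case: insubP => [j /=|_]; first by rewrite ltnn.
  by rewrite eqxx.
have b2 : v.2.2 = 0.
  have := v0 (Ordinal (leqnSn m.+2 : (m.+1 < m.+3)%N)); rewrite /hcoord.
  case: insubP => [j /=|_ /=]; first by rewrite ltnNge leqnSn.
  by rewrite gtn_eqF// eqxx.
by rewrite /rho /modulus a0 b1 b2 normr0 expr0n addr0 sqrtr0 addr0.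
Qed.

Lemma cvg_hcoord T (F : set_system T) (FF : Filter F) (f : T -> V) v i :
  f @ F --> v -> hcoord (f t) i @[t --> F] --> hcoord v i.
Proof.
move=> fv; rewrite /hcoord; case: insubP => [j _ _|_] /=.
  have c1 : (f t).1 @[t --> F] --> v.1 by apply: cvg_comp fv _; exact: cvg_fst.
  exact: (cvg_coord _ c1).
have c2 : (f t).2 @[t --> F] --> v.2 by apply: cvg_comp fv _; exact: cvg_snd.
case: ifP => _; first by apply: cvg_comp c2 _; exact: cvg_fst.
by case: ifP => _; [apply: cvg_comp c2 _; exact: cvg_snd|exact: cvg_cst].
Qed.

(* The ray of v meets the boundary of the simplex on the faces i with
   hcoord v i minimal. *)
Definition min_face v i := forall j, hcoord v i <= hcoord v j.

Lemma min_face_exists v : exists i, min_face v i.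
Proof.
have [i _ mini] := Order.TotalTheory.arg_minP (hcoord v) (isT : xpredT (ord0 : 'I_m.+3)).
by exists i => j; exact: mini.
Qed.

(** Subtracting the minimal coordinate moves the point into the hyperplane of face [i]; this sum
    then normalizes its total mass to 1. *)
Definition face_mass v i := \sum_j (hcoord v j - hcoord v i).

Lemma face_mass_gt0 v i : 0 < rho v -> min_face v i -> 0 < face_mass v i.
Proof.
move=> v0 vi; have ge0 j : 0 <= hcoord v j - hcoord v i by rewrite subr_ge0.
rewrite lt_neqAle sumr_ge0// andbT eq_sym; apply/eqP => /eqP.
rewrite psumr_eq0// => /allP h; move: v0; rewrite hcoord_eq0 ?ltxx// => j.
have e (l : 'I_m.+3) : hcoord v l = hcoord v i.
  by apply/eqP; rewrite -subr_eq0; apply: h; rewrite mem_index_enum.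
by rewrite e -(e ord_max) hcoord_max.
Qed.

Definition face_coord v i : 'rV[R]_m.+2 :=
  \row_j ((hcoord v (lift i j) - hcoord v i) / face_mass v i).

Lemma cvg_face_coord T (F : set_system T) (FF : Filter F) (f : T -> V) v i :
  face_mass v i != 0 -> f @ F --> v -> face_coord (f t) i @[t --> F] --> face_coord v i.
Proof.
move=> vi fv; apply: cvg_rV => j; rewrite mxE; under eq_fun do rewrite mxE.
have cB l : hcoord (f t) l - hcoord (f t) i @[t --> F] --> hcoord v l - hcoord v i.
  by apply: cvgB; exact: cvg_hcoord.
by apply: cvgM => //; apply: cvgV => //; exact: cvg_sumr.
Qed.

Lemma face_coord_simplex v i : 0 < rho v -> min_face v i -> std_simplex (face_coord v i).
Proof.
move=> v0 vi; have s0 := face_mass_gt0 v0 vi; split=> [j|].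
  by rewrite mxE divr_ge0 ?(ltW s0)// subr_ge0.
under eq_bigr do rewrite mxE; rewrite -mulr_suml.
have <- : face_mass v i = \sum_j (hcoord v (lift i j) - hcoord v i).
  by rewrite /face_mass (bigD1_ord i)//= subrr add0r.
by rewrite divff// gt_eqF.
Qed.

Lemma face_row_face_coord v i : 0 < rho v -> min_face v i ->
  face_row i (face_coord v i) = \row_j ((hcoord v j - hcoord v i) / face_mass v i).
Proof.
move=> v0 vi; apply/rowP => j; rewrite !mxE; case: unliftP => [l ->|->] /=.
  by rewrite mxE.
by rewrite subrr mul0r.
Qed.

Variable tau : 'I_m.+3 -> sing R X m.+1.
Hypothesis tauP : forall i j s t, face_fun i s = face_fun j t -> tau i s = tau j t.

Let face_map i v : X := tau i (simplex_retract (face_coord v i)).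

(** At a tie the two faces yield the same point of the simplex, so the compatibility [tauP]
    applies. *)
Lemma face_map_eq v i j : 0 < rho v -> min_face v i -> min_face v j ->
  face_map i v = face_map j v.
Proof.
move=> v0 vi vj; have h : hcoord v i = hcoord v j by apply: le_anti; rewrite vi vj.
pose s l (vl : min_face v l) : simplex R m.+1 := SigSub (mem_set (face_coord_simplex v0 vl)).
have e l (vl : min_face v l) : face_map l v = tau l (s l vl).
  by rewrite /face_map -[in RHS](simplex_retractK (s l vl)).
rewrite (e i vi) (e j vj); apply: tauP; apply: val_inj.
rewrite /= !face_row_face_coord//; apply/rowP => l; rewrite !mxE h.
by rewrite /face_mass h.
Qed.

Let sphere_fun v : X := face_map (xget ord0 (min_face v)) v.

Lemma sphere_funE v i : 0 < rho v -> min_face v i -> sphere_fun v = face_map i v.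
Proof.
move=> v0 vi; apply: face_map_eq => //.
by have [j vj] := min_face_exists v; exact: (xgetPex ord0 (ex_intro _ j vj)).
Qed.

(** A face that is not minimal at [v] is not minimal near [v]; the finitely many others have
    continuous face maps, all with the same value at [v]. *)
Lemma sphere_fun_continuous : continuous_off0 sphere_fun.
Proof.
move=> v v0; apply/metricType_numDomainType.cvgrPdist_lt => e e0.
have nearf i : min_face v i -> \forall u \near v, mdist (sphere_fun v) (face_map i u) < e.
  move=> vi; rewrite (sphere_funE v0 vi).
  have s0 := face_mass_gt0 v0 vi.
  suff : face_map i u @[u --> v] --> face_map i v.
    by move/metricType_numDomainType.cvgr_dist_lt; apply.
  apply: (@cvg_comp _ _ _ (fun u => simplex_retract (face_coord u i)) (tau i) _
    (nbhs (simplex_retract (face_coord v i)))); last exact: cts_fun.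
  apply: cvg_simplex_retract; apply: (@cvg_face_coord _ (nbhs v) _ id) => //.
  by rewrite gt_eqF.
have near_min : \forall u \near v, forall i, min_face u i ->
    mdist (sphere_fun v) (face_map i u) < e.
  apply: (@filter_forall V 'I_m.+3 _ (nbhs v)) => i; have [vi|] := pselect (min_face v i).
    by apply: filterS (nearf i vi) => u ? _.
  move=> /existsNP[j /negP]; rewrite -ltNge -subr_lt0 => ji.
  have c : hcoord u j - hcoord u i @[u --> v] --> hcoord v j - hcoord v i.
    by apply: cvgB; apply: (@cvg_hcoord _ (nbhs v) _ id).
  have near_lt : \forall u \near v, hcoord u j - hcoord u i < 0 by exact: cvgr_lt c _ ji.
  apply: filterS near_lt => u; rewrite subr_lt0 => uij /(_ j).
  by rewrite leNgt uij.
near=> u; have u0 : 0 < rho u by near: u; exact: near_rho_gt.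
have : forall i, min_face u i -> mdist (sphere_fun v) (face_map i u) < e by near: u.
have [i ui] := min_face_exists u; move=> /(_ i ui).
by rewrite (sphere_funE u0 ui).
Unshelve. all: by end_near. Qed.

Lemma sphere_funZ c v : 0 < c -> 0 < rho v -> sphere_fun (c *: v) = sphere_fun v.
Proof.
move=> c0 v0; have [i vi] := min_face_exists v.
have cvi : min_face (c *: v) i by move=> j; rewrite !hcoordZ ler_pM2l.
rewrite (sphere_funE v0 vi) (sphere_funE _ cvi) ?rhoZ ?mulr_gt0 ?(ltW c0)//.
rewrite /face_map; congr (tau _ (simplex_retract _)); apply/rowP => j; rewrite !mxE.
have -> : face_mass (c *: v) i = c * face_mass v i.
  by rewrite /face_mass mulr_sumr; apply: eq_bigr => l _; rewrite !hcoordZ mulrBr.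
by rewrite !hcoordZ -mulrBr -mulf_div divff ?gt_eqF// mul1r.
Qed.

(** The barycentre goes to the origin, and the boundary stays away from it: on face [i] each
    coordinate is a difference of two values of [hcoord], hence at most [2 * rho], and the [m + 3]
    coordinates sum to 1. *)
Lemma hpoint_face_rho i (s : simplex R m.+1) :
  1 <= 2 * m.+3%:R * rho (hpoint (face_row i (\val s))).
Proof.
set t := face_row i (\val s); have [t0 t1] := face_row_simplex i s.
rewrite -/t in t0 t1; have ti : t ord0 i = 0 by rewrite mxE unlift_none.
have tj j : t ord0 j <= 2 * rho (hpoint t).
  have := hcoord_rho (hpoint t) j; have := hcoord_rho (hpoint t) i.
  rewrite !hcoord_hpoint ti; have := ler_norm (t ord0 j - t ord0 ord_max).
  by have := ler_norm (- (0 - t ord0 ord_max)); rewrite normrN; lra.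
rewrite -[leLHS]t1 mulrAC mulr_natr -[m.+3 in leRHS]card_ord -sumr_const.
exact: ler_sum.
Qed.

Lemma cvg_hpoint T (F : set_system T) (FF : Filter F) (f : T -> 'rV[R]_m.+3) t :
  f @ F --> t -> hpoint (f u) @[u --> F] --> hpoint t.
Proof.
move=> ft; have c j : f u ord0 j - f u ord0 ord_max @[u --> F] --> t ord0 j - t ord0 ord_max.
  by apply: cvgB; exact: cvg_coord.
apply: cvg_pairT; last by apply: cvg_pairT; exact: c.
by apply: cvg_rV => j; rewrite mxE; under eq_fun do rewrite mxE; exact: c.
Qed.

Lemma simplex_filling : exists sigma : sing R X m.+2, forall i s,
  sigma (face_fun i s) = tau i s.
Proof.
have [E [cE [a a0 EF]]] := ext sphere_fun_continuous sphere_funZ.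
(* By [hpoint_face_rho], scaling by [c] pushes the boundary of the simplex into the region
   [a <= rho], where [E] is the radial map. *)
pose c := a * (2 * m.+3%:R).
have c0 : 0 < c by rewrite mulr_gt0// mulr_gt0// ltr0n.
pose f (t : simplex R m.+2) := E (c *: hpoint (\val t)).
have cf : continuous f.
  move=> t; apply: (@cvg_comp _ _ _ (fun t : simplex R m.+2 => c *: hpoint (\val t)) E _
    (nbhs (c *: hpoint (\val t)))); last exact: cE.
  apply: (@cvgZ _ _ _ (nbhs t) _ (fun=> c)); first exact: cvg_cst.
  by apply: (@cvg_hpoint _ (nbhs t)); exact: initial_continuous.
pose g : continuousType (simplex R m.+2) X := mkcts cf.
exists g => i s.
set t := face_row i (\val s); have [t0 t1] := face_row_simplex i s.
rewrite -/t in t0 t1; have ti : t ord0 i = 0 by rewrite mxE unlift_none.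
have rt : 1 <= 2 * m.+3%:R * rho (hpoint t) by exact: hpoint_face_rho.
have r0 : 0 < rho (hpoint t).
  rewrite lt_neqAle rho_ge0 andbT; apply: contraTneq rt => <-.
  by rewrite mulr0 -ltNge.
have hi : min_face (hpoint t) i by move=> j; rewrite !hcoord_hpoint ti lerD2r.
rewrite -[LHS]/(E (c *: hpoint t)) EF; last by rewrite rhoZ ?(ltW c0)// /c -mulrA ler_pMr.
rewrite sphere_funZ// (sphere_funE r0 hi) /face_map -[in RHS](simplex_retractK s).
congr (tau _ (simplex_retract _)); apply/rowP => j; rewrite mxE.
have -> : face_mass (hpoint t) i = 1.
  by rewrite -[RHS]t1; apply: eq_bigr => l _; rewrite !hcoord_hpoint ti; ring.
by rewrite !hcoord_hpoint ti /t mxE liftK /= divr1; ring.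
Qed.

End filling.

(** * Contraction of the singular complex *)

Section faces.
Context {R : realType} (X : topologicalType).
Implicit Types (k : nat).

Definition dface k (s : sing R X k.+1) (i : 'I_k.+2) : sing R X k :=
  (s \o face R i : continuousType _ _).

Lemma dfaceE k (s : sing R X k.+1) i t : dface s i t = s (face_fun i t).
Proof. by []. Qed.

(** The hypotheses say that [i] and [j] differ and that [i'] and [j'] are their positions once the
    other is deleted. This symmetric form of the cosimplicial identity spares a split on the order
    of [i] and [j]. *)
Lemma lift_lift n (i j : 'I_n.+2) (i' j' : 'I_n.+1) (l : 'I_n) :
  i = lift j i' -> j = lift i j' -> lift j (lift i' l) = lift i (lift j' l).
Proof.
move=> ij ji; apply: val_inj => /=; rewrite bumpC.
have ij' : i = bump j i' :> nat by rewrite ij.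
have ji' : j = bump i j' :> nat by rewrite {1}ji.
rewrite -ij'; congr (bump _ (bump _ _)).
move: ij' ji'; rewrite /bump /unbump.
by case: (leqP j i'); case: (leqP i j'); case: (ltnP i' j); lia.
Qed.

Lemma face_face k (i j : 'I_k.+3) (i' j' : 'I_k.+2) (u : simplex R k) :
  i = lift j i' -> j = lift i j' -> face_fun j (face_fun i' u) = face_fun i (face_fun j' u).
Proof.
move=> ij ji; apply: val_inj; apply/rowP => l /=; rewrite !mxE.
case: (unliftP j l) => [l1 ->|->] /=; last first.
  by rewrite [in RHS]ji liftK /= mxE unlift_none.
rewrite mxE; case: (unliftP i' l1) => [l2 ->|->] /=; last by rewrite -ij unlift_none.
by rewrite (lift_lift _ ij ji) liftK /= mxE liftK.
Qed.

Lemma dface_dface k (s : sing R X k.+2) (i j : 'I_k.+3) (i' j' : 'I_k.+2) :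
  i = lift j i' -> j = lift i j' -> dface (dface s j) i' = dface (dface s i) j'.
Proof.
by move=> ij ji; apply/continuousEP => u; rewrite !dfaceE (face_face u ij ji).
Qed.

Lemma face_fun_inj k (i : 'I_k.+2) : injective (@face_fun R k i).
Proof.
move=> s t st; apply: val_inj; apply/rowP => l.
have := congr1 (fun v : simplex R k.+1 => \val v ord0 (lift i l)) st.
by rewrite /= !mxE liftK.
Qed.

Lemma face_fun_surj k (j : 'I_k.+2) (s : simplex R k.+1) : \val s ord0 j = 0 ->
  exists u, s = face_fun j u.
Proof.
move=> sj; have [s0 s1] := set_valP s.
have uP : std_simplex (\row_l \val s ord0 (lift j l) : 'rV[R]_k.+1).
  split=> [l|]; first by rewrite mxE.
  under eq_bigr do rewrite mxE.
  by rewrite -[RHS]s1 [RHS](bigD1_ord j)//= sj add0r.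
exists (SigSub (mem_set uP)); apply: val_inj; apply/rowP => l; rewrite /= mxE.
by case: unliftP => [l' ->|->] /=; rewrite ?mxE.
Qed.

(** Two distinct facets meet in a face of codimension 2: [s] vanishes at [j'], so both points come
    from one point [u] of that face, where the hypothesis compares [tau i] and [tau j]. *)
Lemma face_compatible k (tau : 'I_k.+3 -> sing R X k.+1) :
  (forall i j i' j', i = lift j i' -> j = lift i j' -> dface (tau j) i' = dface (tau i) j') ->
  forall i j s t, face_fun i s = face_fun j t -> tau i s = tau j t.
Proof.
move=> tauP i j s t st; have [ij|ij] := eqVneq i j.
  by rewrite -ij in st *; rewrite (face_fun_inj st).
have coord l : \val (face_fun i s) ord0 l = \val (face_fun j t) ord0 l by rewrite st.
have [i' /esym ii'] : exists i', lift j i' = i.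
  by case: (unliftP j i) ij => [i' ->|->]; [exists i'|rewrite eqxx].
have [j' /esym jj'] : exists j', lift i j' = j.
  by case: (unliftP i j) ij => [j' ->|->]; [exists j'|rewrite eqxx].
have [u su] : exists u, s = face_fun j' u.
  apply: face_fun_surj; have := coord j.
  by rewrite /= !mxE {1}jj' liftK unlift_none.
have tu : t = face_fun i' u.
  by apply: (@face_fun_inj _ j); rewrite -st su (face_face u ii' jj').
by rewrite su tu -!dfaceE (tauP _ _ _ _ ii' jj').
Qed.

End faces.

(** * Path components and singular edges *)

Section paths.
Context {R : realType} (X : metricType R).
Implicit Types x y z : X.

Definition joined x y := exists f : R -> X, [/\ continuous f, f 0 = x & f 1 = y].

Lemma joined_refl x : joined x x.
Proof. by exists (fun=> x); split=> // t; exact: cvg_cst. Qed.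

Lemma joined_sym x y : joined x y -> joined y x.
Proof.
move=> [f [cf f0 f1]]; exists (fun t => f (1 - t)); split; rewrite ?subr0 ?subrr//.
move=> t; have c1 : 1 - u @[u --> t] --> 1 - t.
  by apply: cvgB; [exact: cvg_cst|exact: cvg_id].
by apply: cvg_comp c1 _; exact: cf.
Qed.

Lemma joined_trans y x z : joined x y -> joined y z -> joined x z.
Proof.
move=> [f [cf f0 f1]] [g [cg g0 g1]].
pose h (t : R) := if t <= 2^-1 then f (2 * t) else g (2 * t - 1).
have c2 (t : R) : 2 * u @[u --> t] --> 2 * t.
  by apply: cvgM; [exact: cvg_cst|exact: cvg_id].
have cf2 (t : R) : f (2 * u) @[u --> t] --> f (2 * t).
  by apply: cvg_comp (c2 t) _; exact: cf.
have cg2 (t : R) : g (2 * u - 1) @[u --> t] --> g (2 * t - 1).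
  have c3 : 2 * u - 1 @[u --> t] --> 2 * t - 1 by apply: cvgB; [exact: c2|exact: cvg_cst].
  by apply: cvg_comp c3 _; exact: cg.
exists h; split; last first.
- by rewrite /h ifF ?mulr1 ?addrK// -?[2 - 1]/(1 + 1 - 1) ?addrK//; apply/negbTE; lra.
- by rewrite /h ifT ?mulr0//; lra.
move=> t; rewrite /continuous_at; have [t2|t2|t2] := ltgtP t 2^-1.
- rewrite {2}/h (ltW t2); apply: cvg_trans (cf2 t); apply: near_eq_cvg; near=> u.
  have u2 : u < 2^-1 by near: u; exact: lt_nbhsl.
  by rewrite /h (ltW u2).
- rewrite {2}/h leNgt t2; apply: cvg_trans (cg2 t); apply: near_eq_cvg; near=> u.
  have u2 : 2^-1 < u by near: u; exact: lt_nbhsr.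
  by rewrite /h leNgt u2.
- have e2 : 2 * t = 1 by rewrite t2; field.
  have ht : h t = y by rewrite /h t2 lexx -t2 e2.
  apply: (@cvg_alternative R X _ _ _ h (fun u => f (2 * u)) (fun u => g (2 * u - 1))).
  + have -> : h t = f (2 * t) by rewrite ht e2 f1.
    exact: cf2.
  + have -> : h t = g (2 * t - 1) by rewrite ht e2 subrr g0.
    exact: cg2.
  + by apply: nearW => u; rewrite /h; case: ifP; [left|right].
Unshelve. all: by end_near. Qed.

Definition base x : X := xget x (joined x).

Lemma joined_base x : joined x (base x).
Proof. by apply: (xgetPex x); exists x; exact: joined_refl. Qed.

Lemma base_joined x y : joined x y -> base x = base y.
Proof.
move=> xy; have -> : base x = xget x (joined y).
  congr xget; apply/seteqP; split=> z; last exact: joined_trans.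
  by apply: joined_trans; exact: joined_sym.
(* The defaults [x] and [y] differ, but the set is inhabited and neither is taken. *)
rewrite /base /xget; case: pselect => // n; exfalso; apply: n.
by exists y; apply/asboolP/joined_refl.
Qed.

Definition point0 : simplex R 0 := simplex_retract 0.

Lemma simplex0_eq (t : simplex R 0) : t = point0.
Proof.
apply: val_inj; apply/rowP => j; have [_ t1] := set_valP t.
have [_ p1] := set_valP point0.
by move: t1 p1; rewrite !big_ord1 !ord1 => -> ->.
Qed.

Lemma sing0_ext (s t : sing R X 0) : s point0 = t point0 -> s = t.
Proof. by move=> st; apply/continuousEP => u; rewrite (simplex0_eq u). Qed.

Definition edge_row (t : R) : 'rV[R]_2 := \row_j (if j == ord0 then 1 - t else t).

Lemma cvg_edge_row t : edge_row u @[u --> t] --> edge_row t.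
Proof.
apply: cvg_rV => j; rewrite mxE; under eq_fun do rewrite mxE.
by case: ifP => _; [apply: cvgB; [exact: cvg_cst|exact: cvg_id]|exact: cvg_id].
Qed.

(** Face [ord0] omits vertex 0 and is therefore the end [t = 1] of the edge. *)
Lemma edge_row_face (i : 'I_2) :
  edge_row (if i == ord0 then 1 else 0) = \val (face_fun i point0).
Proof.
have [_ p1] := set_valP point0; rewrite big_ord1 in p1.
apply/rowP => j; rewrite /= !mxE; case: unliftP => [l ->|->] /=.
  rewrite [l]ord1 p1; case: (unliftP ord0 i) => [l' ->|->] /=.
    by rewrite subr0.
  by [].
by case: (i == ord0); rewrite ?subrr.
Qed.

Lemma joined_edge (s : sing R X 1) :
  joined (s (face_fun (lift ord0 ord0) point0)) (s (face_fun ord0 point0)).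
Proof.
exists (fun t => s (simplex_retract (edge_row t))); split.
- move=> t; apply: (@cvg_comp _ _ _ (fun t => simplex_retract (edge_row t)) s _
    (nbhs (simplex_retract (edge_row t)))); last exact: cts_fun.
  by apply: cvg_simplex_retract; exact: cvg_edge_row.
- by rewrite (edge_row_face (lift ord0 ord0)) simplex_retractK.
- by rewrite (edge_row_face ord0) simplex_retractK.
Qed.

Lemma edge_joined x y : joined x y -> exists s : sing R X 1,
  s (face_fun (lift ord0 ord0) point0) = x /\ s (face_fun ord0 point0) = y.
Proof.
move=> [f [cf f0 f1]].
have cg : continuous (fun t : simplex R 1 => f (\val t ord0 (lift ord0 ord0))).
  move=> t; apply: (@cvg_comp _ _ _ (fun t : simplex R 1 => \val t ord0 (lift ord0 ord0)) f _
    (nbhs (\val t ord0 (lift ord0 ord0)))); last exact: cf.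
  apply: (@cvg_comp _ _ _ (fun t : simplex R 1 => \val t)
    (fun v : 'rV[R]_2 => v ord0 (lift ord0 ord0)) _ (nbhs (\val t))).
    exact: initial_continuous.
  exact: coord_continuous.
pose g : continuousType (simplex R 1) X := mkcts cg.
have gE (t : simplex R 1) : (g : sing R X 1) t = f (\val t ord0 (lift ord0 ord0)) by [].
by exists g; rewrite !gE -!edge_row_face !mxE.
Qed.

End paths.

Section cone.
Context {R : realType} (X : metricType R).
Hypothesis fill : forall k (tau : 'I_k.+3 -> sing R X k.+1),
  (forall i j s t, face_fun i s = face_fun j t -> tau i s = tau j t) ->
  exists sigma : sing R X k.+2, forall i s, sigma (face_fun i s) = tau i s.

Definition const_sing k (x : X) : sing R X k :=
  (mkcts (@cst_continuous (simplex R k) X x) : continuousType (simplex R k) X).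

(** Vertex 0 is the apex: the face opposite to it is [s], the others are cones over the faces of
    [s]. *)
Definition cone_boundary k (c : sing R X k -> sing R X k.+1) (s : sing R X k.+1)
    (i : 'I_k.+3) : sing R X k.+1 :=
  if unlift ord0 i is Some j then c (dface s j) else s.

(* The cone of s from a base point of its path component; by simplex filling
   the default values of xget are never taken. *)
Fixpoint cone k : sing R X k -> sing R X k.+1 :=
  match k with
  | 0 => fun s => xget (const_sing 1 (s point0)) [set c |
      c (face_fun (lift ord0 ord0) point0) = base (s point0) /\
      c (face_fun ord0 point0) = s point0]
  | k'.+1 => fun s => xget (const_sing k'.+2 (s (simplex_retract 0)))
      [set c | forall i, dface c i = cone_boundary (@cone k') s i]
  end.

Lemma cone0P (s : sing R X 0) : dface (cone s) ord0 = s /\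
  dface (cone s) (lift ord0 ord0) = const_sing 0 (base (s point0)).
Proof.
have [c cP] := edge_joined (joined_sym (joined_base (s point0))).
have [e1 e0] : cone s (face_fun (lift ord0 ord0) point0) = base (s point0) /\
    cone s (face_fun ord0 point0) = s point0.
  exact: (xgetPex (const_sing 1 (s point0)) (ex_intro (fun c : sing R X 1 =>
    c (face_fun (lift ord0 ord0) point0) = base (s point0) /\
    c (face_fun ord0 point0) = s point0) c cP)).
by split; apply: sing0_ext; rewrite dfaceE.
Qed.

(** The prescribed faces must agree in codimension 2: the first hypothesis settles the pairs
    containing the face opposite the apex, the second the other pairs. The second is assumed here
    because its proof for [k = 0] differs from that for higher [k]. *)
Lemma cone_step k (s : sing R X k.+1) :
  (forall s : sing R X k, dface (cone s) ord0 = s) ->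
  (forall (i j : 'I_k.+2) (i' j' : 'I_k.+1), i = lift j i' -> j = lift i j' ->
     dface (cone (dface s j)) (lift ord0 i') = dface (cone (dface s i)) (lift ord0 j')) ->
  forall i, dface (cone s) i = cone_boundary (@cone k) s i.
Proof.
move=> face0 faceS.
suff [c cP] : exists c : sing R X k.+2, forall i, dface c i = cone_boundary (@cone k) s i.
  exact: (xgetPex (const_sing k.+2 (s (simplex_retract 0)))
    (ex_intro (fun c => forall i, dface c i = cone_boundary (@cone k) s i) c cP)).
suff compat : forall (i j : 'I_k.+3) (i' j' : 'I_k.+2), i = lift j i' -> j = lift i j' ->
    dface (cone_boundary (@cone k) s j) i' = dface (cone_boundary (@cone k) s i) j'.
  have [c cP] := fill (face_compatible compat).
  by exists c => i; apply/continuousEP => t; rewrite dfaceE cP.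
have lift0 (j1 i' : 'I_k.+2) : lift (lift ord0 j1) i' = ord0 -> i' = ord0.
  move=> /(congr1 val) /= e; apply: val_inj; move: e => /=.
  by rewrite {1}/bump => /eqP; rewrite addn_eq0 => /andP[_ /eqP].
have zero (j1 i' : 'I_k.+2) : lift (lift ord0 j1) i' = ord0 ->
    dface (cone_boundary (@cone k) s (lift ord0 j1)) i' =
    dface (cone_boundary (@cone k) s ord0) j1.
  by move=> /lift0 ->; rewrite /cone_boundary liftK unlift_none face0.
move=> i j i' j' ij ji; case: (unliftP ord0 i) => [i1 ei|ei]; last first.
  have ej : j = lift ord0 j' by rewrite {1}ji ei.
  by rewrite ei ej; apply: zero; rewrite -ej -ij.
case: (unliftP ord0 j) => [j1 ej|ej]; last first.
  have ei' : i = lift ord0 i' by rewrite {1}ij ej.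
  by rewrite ej ei'; apply/esym/zero; rewrite -ei' -ji.
have [i2 ei2] : exists i2, i' = lift ord0 i2.
  case: (unliftP ord0 i') => [i2 ->|e]; first by exists i2.
  by move: ij; rewrite ei ej e => /(congr1 val).
have [j2 ej2] : exists j2, j' = lift ord0 j2.
  case: (unliftP ord0 j') => [j2 ->|e]; first by exists j2.
  by move: ji; rewrite ei ej e => /(congr1 val).
have liftS (a : 'I_k.+2) (b : 'I_k.+1) :
    lift (lift ord0 a) (lift ord0 b) = lift ord0 (lift a b).
  apply: val_inj; rewrite /= -[bump 0 a]/a.+1 -[bump 0 b]/b.+1 bumpS.
  by [].
rewrite ei ej ei2 ej2 !liftS in ij ji *.
by rewrite /cone_boundary !liftK; apply: faceS; [move/lift_inj: ij|move/lift_inj: ji].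
Qed.

(** At the start, the cones over the two ends of an edge need the same base point; they have it
    because the edge joins its ends and [base] depends only on the path component. Afterwards
    [dface_dface] and the induction hypothesis suffice. *)
Lemma coneP k : (forall s : sing R X k, dface (cone s) ord0 = s) /\
  forall (s : sing R X k.+1) i, dface (cone s) i = cone_boundary (@cone k) s i.
Proof.
elim: k => [|k [IH0 IH]].
  have face0 (s : sing R X 0) : dface (cone s) ord0 = s by have [] := cone0P s.
  split=> // s; apply: cone_step => // i j i' j' ij ji.
  rewrite [i']ord1 [j']ord1.
  have [_ ->] := cone0P (dface s j); have [_ ->] := cone0P (dface s i).
  rewrite !dfaceE; have e := base_joined (joined_edge s).
  have dich (l : 'I_2) : l = ord0 \/ l = lift ord0 ord0.
    by case: (unliftP ord0 l) => [l' ->|->]; [right; rewrite [l']ord1|left].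
  by case: (dich i) => ->; case: (dich j) => ->; rewrite ?e.
have face0 (s : sing R X k.+1) : dface (cone s) ord0 = s.
  by rewrite IH /cone_boundary unlift_none.
split=> // s; apply: cone_step => // i j i' j' ij ji.
by rewrite !IH /cone_boundary !liftK (dface_dface s ij ji).
Qed.

Lemma cone_face0 k (s : sing R X k) : dface (cone s) ord0 = s.
Proof. by have [] := coneP k. Qed.

Lemma cone_faceS k (s : sing R X k.+1) i :
  dface (cone s) (lift ord0 i) = cone (dface s i).
Proof. by have [_ ->] := coneP k; rewrite /cone_boundary liftK. Qed.

HB.instance Definition _ (K : choiceType) (M : lmodType int) (f : K -> M) :=
  GRing.isZmodMorphism.Build {freeg K / int} M (fglift f) (lift_is_additive f).

Lemma fglift0 (K : choiceType) (M : lmodType int) (f : K -> M) :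
  fglift f (0 : {freeg K / int}) = 0.
Proof. exact: raddf0. Qed.

Lemma fgliftD (K : choiceType) (M : lmodType int) (f : K -> M) :
  {morph fglift f : D D' / D + D'}.
Proof. exact: raddfD. Qed.

Lemma fglift_sum (K : choiceType) (M : lmodType int) (f : K -> M) (I : finType)
  (D : I -> {freeg K / int}) : fglift f (\sum_i D i) = \sum_i fglift f (D i).
Proof. exact: raddf_sum. Qed.

Lemma fgliftZ (K : choiceType) (M : lmodType int) (f : K -> M) (k : int)
  (D : {freeg K / int}) : fglift f (k *: D) = k *: fglift f D.
Proof. by rewrite -[k]intz !scaler_int raddfMz. Qed.

Lemma freegZ (K : choiceType) (k : int) (x : K) :
  << k *g x >> = k *: << x >> :> {freeg K / int}.
Proof. by rewrite -[k in RHS]intz scaler_int freegU_mulz intz. Qed.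

Definition cone_chain k : chain R X k -> chain R X k.+1 :=
  fglift (fun s => << cone s >>).

Lemma boundary_sing_cone k (s : sing R X k.+1) :
  boundary_sing (cone s) = << s >> - cone_chain (boundary_sing s).
Proof.
rewrite /boundary_sing big_ord_recl expr0 scale1r; congr (_ + _).
  by congr (<< _ >>); exact: cone_face0.
rewrite /cone_chain fglift_sum -sumrN; apply: eq_bigr => i _.
rewrite fgliftZ liftU scale1r -scaleNr exprS mulN1r; congr (_ *: << _ >>).
exact: cone_faceS.
Qed.

(** A chain homotopy between the identity and 0. Degrees start at 1: the cone over a 0-simplex has a
    base point as second face, and its boundary keeps that point. *)
Lemma boundary_cone k (c : chain R X k.+1) :
  boundary (cone_chain c) = c - cone_chain (boundary c).
Proof.
elim/freeg_ind_dom0: c => [|n s c _ _ IH].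
  by rewrite boundary0 /cone_chain !fglift0 boundary0 subr0.
have boundaryD l (a b : chain R X l.+1) : boundary (a + b) = boundary a + boundary b.
  exact: fgliftD.
have coneD l (a b : chain R X l) : cone_chain (a + b) = cone_chain a + cone_chain b.
  exact: fgliftD.
rewrite coneD !boundaryD coneD IH.
rewrite opprD addrACA; congr (_ + _).
rewrite /cone_chain /boundary !liftU !fgliftZ liftU boundary_sing_cone scale1r.
by rewrite [<< n *g s >>]freegZ -scalerBr.
Qed.

Lemma homology_eq0 k (h : homology R X k.+1) : h = 0.
Proof.
rewrite -[h]reprK; set z := repr h.
have z0 : boundary z = 0 by apply/eqP; case: z.
apply/eqP; rewrite piE.
apply/asboolP; exists (cone_chain z).
by rewrite boundary_cone z0 /cone_chain fglift0 !subr0.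
Qed.

End cone.

Theorem theorem1p3 (R : realType) (X : metricType R) (K : R) (k0 : nat) :
  closed_space R X ->
  curvature_bounded_above X K ->
  (1 <= k0)%N ->
  (exists h : homology R X k0, h != 0) ->
  exists g : R -> X, closed_geodesic g /\ ~ constant_curve g.
Proof.
move=> [cX _] curvK; case: k0 => // k _ [h /eqP h0].
have [r r0 ug] := curvature_uniquely_geodesic cX curvK.
(* Fillings are needed for all [m] at once, since the cone in one degree is built from those in the
   lower degrees. *)
apply: contrapT => nogeod; apply: h0; apply: homology_eq0 => m tau.
apply: simplex_filling => F cF FZ; apply: (sphere_extendable cX ug r0) => // g gg.
by apply: contrapT => gc; apply: nogeod; exists g.
Qed.
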